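(* Let $u$ be a power of $2$ and let $P$ be a set of $n$ points on the $u\times u$ integer grid, such that every internal node of the quadtree of $P$ has at least one descendant storing $0$ (equivalently, every leaf of the quadtree storing $1$ is at depth $\lg u$). Then, in the word-RAM model with words of $\Theta(\log u)$ bits, there is a data structure storing $P$ using $O(1)$ bits per node of the quadtree of $P$ that answers a membership query for any grid point $(x,y)$ (i.e., decides whether $(x,y)\in P$) in time $$O\!\left(\min_{g}\{\log(u/g) + \log k_g\}\right) \subseteq O(\log n),$$ where the minimum ranges over $1 \le g \le u$ and $k_g$ denotes the number of points of $P$ within distance $g$ of $(x,y)$.
   Context: The quadtree of a point set $P$ on a $u\times u$ grid ($u$ a power of $2$) is defined recursively: if the grid contains $0$ points of $P$ (resp. all $u^2$ of its cells belong to $P$), the quadtree is a single root node storing $0$ (resp. $1$); otherwise the root stores $1$ and has four children, which are the quadtrees of the four $(u/2)\times(u/2)$ quadrants of the grid with respect to the points of $P$ lying in them. Distances are Euclidean. *)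

(* Defs.v *)
From mathcomp Require Import all_boot all_order all_algebra.
From mathcomp Require Import all_classical all_reals all_analysis.
Set Implicit Arguments.
Unset Strict Implicit.
Unset Printing Implicit Defensive.
Import Order.TTheory GRing.Theory Num.Theory.
Local Open Scope nat_scope.

(** * Grids and quadtrees (MathComp world).  The grid has side [u = 2 ^ m]. *)

Definition cell (m : nat) : finType := ('I_(2 ^ m) * 'I_(2 ^ m))%type.

Lemma half_coord_subproof (m : nat) (b : bool) (i : 'I_(2 ^ m)) :
  b * 2 ^ m + i < 2 ^ m.+1.
Proof.
by rewrite expnS mul2n -addnn -addnS leq_add // -{2}[2 ^ m]mul1n leq_mul2r leq_b1 orbT.
Qed.

(* Position [i] of the lower ([b = false]) or upper ([b = true]) half. *)
Definition half_coord (m : nat) (b : bool) (i : 'I_(2 ^ m)) : 'I_(2 ^ m.+1) :=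
  Ordinal (half_coord_subproof b i).

Definition quadrant (m : nat) (P : {set cell m.+1}) (a b : bool) :
    {set cell m} :=
  finset (fun c : cell m => (half_coord a c.1, half_coord b c.2) \in P).

(* [QNode] is an internal node; it stores the bit 1, so only leaves carry an
   explicit bit. *)
Inductive qtree : Type :=
| QLeaf of bool
| QNode of qtree & qtree & qtree & qtree.

Fixpoint quadtree (m : nat) : {set cell m} -> qtree :=
  match m return {set cell m} -> qtree with
  | 0 => fun P => QLeaf (P != finset.set0)
  | k.+1 => fun P =>
      if P == finset.set0 then QLeaf false
      else if P == finset.setTfor (cell k.+1) then QLeaf true
      else QNode (quadtree (quadrant P false false))
                 (quadtree (quadrant P false true))
                 (quadtree (quadrant P true false))
                 (quadtree (quadrant P true true))
  end.

Fixpoint num_nodes (t : qtree) : nat :=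
  match t with
  | QLeaf _ => 1
  | QNode t1 t2 t3 t4 =>
      (num_nodes t1 + num_nodes t2 + num_nodes t3 + num_nodes t4).+1
  end.

(* The leaves of a tree rooted at depth [d], as pairs (depth, stored bit). *)
Fixpoint leaves_from (d : nat) (t : qtree) : seq (nat * bool) :=
  match t with
  | QLeaf b => [:: (d, b)]
  | QNode t1 t2 t3 t4 =>
      leaves_from d.+1 t1 ++ leaves_from d.+1 t2 ++
      leaves_from d.+1 t3 ++ leaves_from d.+1 t4
  end.

Definition leaves (t : qtree) : seq (nat * bool) := leaves_from 0 t.

(* Every leaf storing 1 is at depth [lg u = m], i.e. every node above the
   bottom level that stores 1 has a descendant storing 0.  (A [QNode] of a
   quadtree has such a descendant in any case, because full grids are
   contracted to leaves; the content is that no contraction occurs above the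
   bottom level.) *)
Definition ones_at_bottom (m : nat) (P : {set cell m}) : Prop :=
  forall d : nat, (d, true) \in leaves (quadtree P) -> d = m.

(** * The word RAM with [w]-bit words *)

Definition word (w : nat) : finType := 'I_(2 ^ w).

Lemma to_word_subproof (w n : nat) : n %% 2 ^ w < 2 ^ w.
Proof. by rewrite ltn_mod expn_gt0. Qed.

Definition to_word (w n : nat) : word w := Ordinal (to_word_subproof w n).

Inductive binop : Type :=
| OpAdd | OpSub | OpMul | OpDiv | OpMod
| OpAnd | OpOr | OpXor | OpShl | OpShr
| OpEq | OpLt.

(* Results are reduced modulo [2 ^ w] by [to_word]; subtraction wraps around,
   comparisons yield 0 or 1. *)
Definition binop_sem (w : nat) (o : binop) (a b : word w) : word w :=
  to_word w
    match o with
    | OpAdd => a + b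
    | OpSub => a + 2 ^ w - b
    | OpMul => a * b
    | OpDiv => a %/ b
    | OpMod => a %% b
    | OpAnd => Nat.land a b
    | OpOr => Nat.lor a b
    | OpXor => Nat.lxor a b
    | OpShl => a * 2 ^ b
    | OpShr => a %/ 2 ^ b
    | OpEq => (a == b)%N
    | OpLt => (a < b)%N
    end.

(* A program mentions finitely many registers, which are named by numbers. *)
Inductive instr : Type :=
| IConst of nat & nat            (* IConst r n    : r := n *)
| IOp of binop & nat & nat & nat (* IOp o r r1 r2 : r := r1 o r2 *)
| ILoad of nat & nat             (* ILoad r a     : r := mem[a] *)
| IStore of nat & nat.           (* IStore a r    : mem[a] := r *)

Inductive prog : Type :=
| PSkip
| PInstr of instr
| PSeq of prog & prog
| PIf of nat & prog & prog       (* branches on a register being nonzero *)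
| PWhile of nat & prog.          (* loops while a register is nonzero *)

Record state (w : nat) : Type := State {
  regs : nat -> word w;
  memory : word w -> word w
}.

Definition upd (A : eqType) (B : Type) (f : A -> B) (a : A) (b : B) : A -> B :=
  fun a' => if a' == a then b else f a'.

Definition instr_sem (w : nat) (i : instr) (s : state w) : state w :=
  match i with
  | IConst r n => State (upd (regs s) r (to_word w n)) (memory s)
  | IOp o r r1 r2 =>
      State (upd (regs s) r (binop_sem o (regs s r1) (regs s r2))) (memory s)
  | ILoad r a => State (upd (regs s) r (memory s (regs s a))) (memory s)
  | IStore a r => State (regs s) (upd (memory s) (regs s a) (regs s r))
  end.

(* [exec p s t s']: started in [s], [p] halts in [s'] after exactly [t] time
   units; every instruction and every test costs one unit. *)
Inductive exec (w : nat) : prog -> state w -> nat -> state w -> Prop :=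
| ExecSkip s : exec PSkip s 1 s
| ExecInstr i s : exec (PInstr i) s 1 (instr_sem i s)
| ExecSeq p q s1 s2 s3 t1 t2 :
    exec p s1 t1 s2 -> exec q s2 t2 s3 -> exec (PSeq p q) s1 (t1 + t2) s3
| ExecIfTrue r p q s s' t :
    regs s r != 0 :> nat -> exec p s t s' -> exec (PIf r p q) s t.+1 s'
| ExecIfFalse r p q s s' t :
    regs s r = 0 :> nat -> exec q s t s' -> exec (PIf r p q) s t.+1 s'
| ExecWhileTrue r p s1 s2 s3 t1 t2 :
    regs s1 r != 0 :> nat -> exec p s1 t1 s2 ->
    exec (PWhile r p) s2 t2 s3 -> exec (PWhile r p) s1 (t1 + t2).+1 s3
| ExecWhileFalse r p s :
    regs s r = 0 :> nat -> exec (PWhile r p) s 1 s.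

(* The bit string [B] is packed into memory from address 0 on, [w] bits per
   word; the contents of all remaining bits of the memory are unconstrained. *)
Definition stores (w : nat) (M : word w -> word w) (B : seq bool) : Prop :=
  forall i : nat, i < size B ->
    Nat.testbit (M (to_word w (i %/ w))) (i %% w) = nth false B i.

(* Start of a query: the coordinates are in registers 0 and 1, all other
   registers are 0. *)
Definition query_state (w m : nat) (M : word w -> word w) (c : cell m) :
    state w :=
  State (fun r => to_word w (if r == 0 then c.1 : nat
                             else if r == 1 then c.2 : nat else 0)) M.

(* On every memory holding [B], [p] answers the query [c] for membership in [P]
   in exactly [t] steps at most [T], and leaves [B] intact. *)
Definition answers (R : realType) (w m : nat) (p : prog) (B : seq bool)
    (P : {set cell m}) (c : cell m) (T : R) : Prop :=
  forall M : word w -> word w, stores M B ->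
    exists (t : nat) (s : state w),
      [/\ exec p (query_state M c) t s,
          regs s 0 = (c \in P) :> nat,
          stores (memory s) B
        & (t%:R <= T)%R].

(** * The query bound *)

Definition lg (R : realType) (x : R) : R := (ln x / ln 2)%R.

Definition dist (R : realType) (m : nat) (p q : cell m) : R :=
  Num.sqrt (((p.1 : nat)%:R - (q.1 : nat)%:R) ^+ 2
          + ((p.2 : nat)%:R - (q.2 : nat)%:R) ^+ 2)%R.

(* [k_g] *)
Definition num_within (R : realType) (m : nat) (P : {set cell m}) (c : cell m)
    (g : R) : nat :=
  #|[pred p : cell m | (p \in P) && (dist R p c <= g)%R]|.

(* [min_g (lg (u / g) + lg k_g)] over real [1 <= g <= u].  It is an infimum,
   as [k_g] is a step function of [g]; over the integers [g] it would be
   attained and larger by at most 1.  [lg k_g] is read as 0 when [k_g = 0]. *)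
Definition query_bound (R : realType) (m : nat) (P : {set cell m})
    (c : cell m) : R :=
  inf (fun v : R => exists g : R,
    [/\ (1 <= g)%R, (g <= (2 ^ m)%:R)%R
      & v = (lg ((2 ^ m)%:R / g) + lg (maxn 1 (num_within P c g))%:R)%R]).

(* Main.v *)
(* Write the points as Z-order codes (interleaved coordinates), so that the cells
   of the grid are intervals of codes, and keep the sorted codes in a binary search
   tree.  A node [s] strictly between its nearest ancestors [lo < s < hi] stores
   only the coordinate bits of [s] below the height at which [s] branches off from
   the closer of [lo] and [hi]; since split heights are ultrametric, these lengths
   add up to at most the number of quadtree nodes, whatever the shape of the tree.
   The pointer past the subtree on the closer side has a length of the same order,
   because that subtree lies in the common cell of [s] and the closer bound.

   The shape is therefore free to serve the queries: steps that split the current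
   cell alternate with steps that take the median.  After [i] rounds the remaining
   keys share a cell of depth [i], after two more comparisons (with the least and
   the greatest key) that cell contains the query point or the search has ended,
   and [O(log k)] rounds finish the [k] points left. *)
From Stdlib Require Import PeanoNat.
Require Import Defs.
From mathcomp Require Import all_boot all_order all_algebra.
From mathcomp Require Import all_classical all_reals all_analysis.
From mathcomp Require Import zify lra.
Set Implicit Arguments.
Unset Strict Implicit.
Unset Printing Implicit Defensive.
Import Order.TTheory GRing.Theory Num.Theory.
Local Open Scope nat_scope.

(** * Z-order codes *)

(** The [x] bit is the higher one in each base-4 digit, so the leading digit numbers the quadrants
    in the order of the children in [quadtree]. *)
Fixpoint zcode (m x y : nat) : nat :=
  if m is k.+1 then 4 * zcode k x./2 y./2 + 2 * odd x + odd y else 0.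

Fixpoint xcoord (m z : nat) : nat :=
  if m is k.+1 then 2 * xcoord k (z %/ 4) + odd (z %/ 2) else 0.

Fixpoint ycoord (m z : nat) : nat :=
  if m is k.+1 then 2 * ycoord k (z %/ 4) + odd z else 0.

Lemma zcode_lt m x y : zcode m x y < 4 ^ m.
Proof.
elim: m x y => [|m IH] x y; first by [].
by have := IH x./2 y./2; rewrite expnS /=; case: (odd x); case: (odd y); lia.
Qed.

Lemma xcoord_lt m z : xcoord m z < 2 ^ m.
Proof.
elim: m z => [|m IH] z; first by [].
by have := IH (z %/ 4); rewrite expnS /=; case: odd; lia.
Qed.

Lemma ycoord_lt m z : ycoord m z < 2 ^ m.
Proof.
elim: m z => [|m IH] z; first by [].
by have := IH (z %/ 4); rewrite expnS /=; case: odd; lia.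
Qed.

Lemma xcoord_zcode m x y : x < 2 ^ m -> xcoord m (zcode m x y) = x.
Proof.
elim: m x y => [|m IH] x y /=; first by rewrite expn0; lia.
rewrite expnS => hx.
have -> : (4 * zcode m x./2 y./2 + 2 * odd x + odd y) %/ 4 = zcode m x./2 y./2.
  by case: (odd x); case: (odd y); lia.
rewrite IH; last by lia.
have -> : (4 * zcode m x./2 y./2 + 2 * odd x + odd y) %/ 2 =
  2 * zcode m x./2 y./2 + odd x by case: (odd x); case: (odd y); lia.
by rewrite oddD oddM /= oddb; lia.
Qed.

Lemma ycoord_zcode m x y : y < 2 ^ m -> ycoord m (zcode m x y) = y.
Proof.
elim: m x y => [|m IH] x y /=; first by rewrite expn0; lia.
rewrite expnS => hy.
have -> : (4 * zcode m x./2 y./2 + 2 * odd x + odd y) %/ 4 = zcode m x./2 y./2.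
  by case: (odd x); case: (odd y); lia.
rewrite IH; last by lia.
by case: (odd x); case: (boolP (odd y)); lia.
Qed.

Lemma xcoord_div h m z : h <= m -> xcoord m z %/ 2 ^ h = xcoord (m - h) (z %/ 4 ^ h).
Proof.
elim: h m z => [|h IH] [|m] z //=; rewrite ?expn0 ?divn1 //.
move=> hm; rewrite subSS !expnS !divnMA -IH //.
by congr (_ %/ _); case: odd; lia.
Qed.

Lemma ycoord_div h m z : h <= m -> ycoord m z %/ 2 ^ h = ycoord (m - h) (z %/ 4 ^ h).
Proof.
elim: h m z => [|h IH] [|m] z //=; rewrite ?expn0 ?divn1 //.
move=> hm; rewrite subSS !expnS !divnMA -IH //.
by congr (_ %/ _); case: odd; lia.
Qed.

(** [zcode] peels off the lowest bits, the quadtree the highest; this recursion from the top matches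
    the quadrants. *)
Lemma zcode_top m (a b : bool) x y : x < 2 ^ m -> y < 2 ^ m ->
  zcode m.+1 (a * 2 ^ m + x) (b * 2 ^ m + y) = (2 * a + b) * 4 ^ m + zcode m x y.
Proof.
elim: m x y => [|m IH] x y.
  by rewrite expn0 !ltnS !leqn0 => /eqP -> /eqP ->; case: a; case: b.
move=> hx hy.
have half_top (c : bool) u : (c * 2 ^ m.+1 + u)./2 = c * 2 ^ m + u./2.
  by rewrite expnS; case: c; lia.
have odd_top (c : bool) u : odd (c * 2 ^ m.+1 + u) = odd u.
  by rewrite oddD oddM expnS oddM andbF.
rewrite [LHS]/= half_top odd_top half_top odd_top.
move: IH => /(_ x./2 y./2) /=; rewrite expnS in hx hy => -> //; try lia.
by rewrite expnS; lia.
Qed.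

(* The coordinate whose difference has the higher leading bit decides the Z-order;
   the leading bit of [a] is below that of [b] iff [a < b] and [a < a xor b]. *)
Definition zless (x y x' y' : nat) : bool :=
  let dx := Nat.lxor x x' in
  let dy := Nat.lxor y y' in
  if (dx < dy) && (dx < Nat.lxor dx dy) then y < y' else x < x'.

Lemma lxor_bit (a b : nat) (i j : bool) :
  Nat.lxor (2 * a + i) (2 * b + j) = 2 * Nat.lxor a b + (i (+) j).
Proof.
have E (c : nat) (k : bool) : 2 * c + k = Nat.add (Nat.mul 2 c) (Nat.b2n k).
  by case: k.
have X : i (+) j = xorb i j by case: i; case: j.
rewrite !E X; apply: Nat.bits_inj => -[|n].
  by rewrite Nat.lxor_spec !Nat.testbit_0_r.
by rewrite Nat.lxor_spec !Nat.testbit_succ_r Nat.lxor_spec.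
Qed.

Lemma lxor_eq0 a b : (Nat.lxor a b == 0) = (a == b).
Proof.
apply/eqP/eqP => [|->]; first exact: Nat.lxor_eq.
exact: Nat.lxor_nilpotent.
Qed.

Lemma coord_eq m z z' : z < 4 ^ m -> z' < 4 ^ m ->
  (xcoord m z == xcoord m z') && (ycoord m z == ycoord m z') = (z == z').
Proof.
elim: m z z' => [|m IH] z z'.
  by rewrite expn0 !ltnS !leqn0 => /eqP -> /eqP ->.
rewrite expnS => hz hz'; have /= := IH (z %/ 4) (z' %/ 4).
have D (u : nat) : u = 4 * (u %/ 4) + 2 * odd (u %/ 2) + odd u by lia.
move=> /(_ ltac:(lia) ltac:(lia)); move: (D z) (D z').
move: (xcoord m (z %/ 4)) (ycoord m (z %/ 4)) => x y.
move: (xcoord m (z' %/ 4)) (ycoord m (z' %/ 4)) => x' y'.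
move: (z %/ 4) (z' %/ 4) => u u'.
by case: (odd (z %/ 2)); case: (odd z); case: (odd (z' %/ 2)); case: (odd z'); lia.
Qed.

(** If [dx < dy], then [dy] is nonzero, so [dd] differs from [dx] and both comparisons are decided
    before the low bits. If [dx = dy], then [dd = 0] and a comparison fails on each side. *)
Lemma less_msb_bit dx dy i j k : i <= 1 -> j <= 1 -> k <= 1 -> (dx != 0) || (dy != 0) ->
  let dd := Nat.lxor dx dy in
  (2 * dx + i < 2 * dy + j) && (2 * dx + i < 2 * dd + k) = (dx < dy) && (dx < dd).
Proof.
move=> hi hj hk /= h0; have := lxor_eq0 dx dy.
have : (Nat.lxor dx dy == dx) = (dy == 0).
  by rewrite -lxor_eq0 Nat.lxor_comm -Nat.lxor_assoc Nat.lxor_nilpotent Nat.lxor_0_l.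
move: (Nat.lxor dx dy) => dd.
case: (ltngtP dx dy) => [lt|gt|eq] E1 E2 /=.
- by case: (ltngtP dx dd) => H; apply/andP; lia.
- by lia.
- by lia.
Qed.

(** Induction on the lowest digit: when the higher parts differ, [less_msb_bit] keeps the choice of
    coordinate; when they agree, the last two bits decide, [x] first. *)
Lemma zless_coord m z z' : z < 4 ^ m -> z' < 4 ^ m ->
  zless (xcoord m z) (ycoord m z) (xcoord m z') (ycoord m z') = (z < z').
Proof.
elim: m z z' => [|m IH] z z'.
  by rewrite expn0 !ltnS !leqn0 => /eqP -> /eqP ->.
rewrite expnS => hz hz'.
have {IH} := IH (z %/ 4) (z' %/ 4) ltac:(lia) ltac:(lia).
have := @coord_eq m (z %/ 4) (z' %/ 4) ltac:(lia) ltac:(lia).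
have D (u : nat) : u = 4 * (u %/ 4) + 2 * odd (u %/ 2) + odd u by lia.
move: (D z) (D z'); rewrite /= /zless !lxor_bit; clear.
move: (xcoord m (z %/ 4)) (ycoord m (z %/ 4)) => x y.
move: (xcoord m (z' %/ 4)) (ycoord m (z' %/ 4)) => x' y'.
move: (z %/ 4) (z' %/ 4) (odd (z %/ 2)) (odd z) (odd (z' %/ 2)) (odd z').
move=> u u' i j i' j' -> ->.
have := lxor_eq0 x x'; have := lxor_eq0 y y'.
set dx := Nat.lxor x x'; set dy := Nat.lxor y y' => hy hx.
have [eq_x|ne_x] := eqVneq x x'; last first.
  rewrite less_msb_bit ?leq_b1 ?hx ?ne_x //= => hu.
  have {hu}ne_u : u != u' by rewrite -hu.
  case: (boolP ((dx < dy) && (dx < Nat.lxor dx dy))) => [/andP [lt _]|_] E; last first.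
    by clear -ne_x ne_u E; case: i; case: i'; case: j; case: j' => /=; lia.
  have ne_y : y != y' by rewrite -hy; lia.
  by clear -ne_y ne_u E; case: i; case: i'; case: j; case: j' => /=; lia.
have [eq_y|ne_y] := eqVneq y y'; last first.
  rewrite less_msb_bit ?leq_b1 ?hy ?ne_y ?orbT //= => hu.
  have {hu}ne_u : u != u' by rewrite -hu.
  have -> : (dx < dy) && (dx < Nat.lxor dx dy).
    by move: hx hy; rewrite eq_x eqxx (negbTE ne_y) => /eqP ->; rewrite Nat.lxor_0_l; lia.
  move=> E.
  by clear -ne_y ne_u E; case: i; case: i'; case: j; case: j' => /=; lia.
move=> /= /esym/eqP -> _.
move: hx hy; rewrite eq_x eq_y !eqxx => /eqP -> /eqP ->.
by case: i; case: i'; case: j; case: j' => /=; lia.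
Qed.

(** * Search trees over codes *)

(** For codes below [4 ^ m], the height of the smallest quadtree cell containing both. *)
Fixpoint split_height (m a b : nat) : nat :=
  if m is k.+1 then
    if a == b then 0 else (split_height k (a %/ 4) (b %/ 4)).+1
  else 0.

(** Fixes the split height through its upper bounds, so that identities between split heights become
    equalities of quotients by [eq_from_leq]. *)
Lemma split_height_le m a b h : a < 4 ^ m -> b < 4 ^ m ->
  (split_height m a b <= h) = (a %/ 4 ^ h == b %/ 4 ^ h).
Proof.
elim: m a b h => [|m IH] a b h.
  by rewrite expn0 !ltnS !leqn0 => /eqP -> /eqP ->; rewrite eqxx.
rewrite expnS => ha hb /=; have [->|ne] := eqVneq a b; first by rewrite eqxx.
case: h => [|h]; first by rewrite expn0 !divn1 (negbTE ne).
by rewrite ltnS IH ?expnS ?divnMA //; lia.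
Qed.

Lemma split_height_bound m a b : split_height m a b <= m.
Proof. by elim: m a b => [|m IH] a b //=; case: eqP => // _; rewrite ltnS. Qed.

Lemma eq_from_leq (a b : nat) : (forall h, (a <= h) = (b <= h)) -> a = b.
Proof. by move=> E; apply/eqP; rewrite eqn_leq E leqnn -E leqnn. Qed.

(** Quotients by [4 ^ h] are monotone, so the outer two agree exactly when the middle one agrees
    with both. *)
Lemma split_height_max m a b c : a <= b -> b <= c -> c < 4 ^ m ->
  split_height m a c = maxn (split_height m a b) (split_height m b c).
Proof.
move=> ab bc hc; have hb := leq_ltn_trans bc hc; have ha := leq_ltn_trans ab hb.
apply: eq_from_leq => h; rewrite geq_max !split_height_le //.
have := leq_div2r (4 ^ h) ab; have := leq_div2r (4 ^ h) bc.
move: (_ %/ _) (_ %/ _) (_ %/ _) => a' b' c'; lia.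
Qed.

Lemma block_lt m c a : c < 4 -> a < 4 ^ m -> c * 4 ^ m + a < 4 ^ m.+1.
Proof.
move=> hc ha; rewrite expnS; apply: leq_trans (_ : c.+1 * 4 ^ m <= _).
  by rewrite mulSn addnC ltn_add2r.
by rewrite leq_mul2r hc orbT.
Qed.

Lemma split_height_shift m c a b : a < 4 ^ m -> b < 4 ^ m -> c < 4 ->
  split_height m.+1 (c * 4 ^ m + a) (c * 4 ^ m + b) = split_height m a b.
Proof.
move=> ha hb hc; apply: eq_from_leq => h.
rewrite split_height_le ?block_lt //.
have [hm|/ltnW hm] := leqP h m.
  rewrite split_height_le // -{1 2}(subnK hm) expnD mulnA.
  by rewrite !divnMDl ?expn_gt0 // eqn_add2l.
have -> : 4 ^ h = 4 ^ m * 4 ^ (h - m) by rewrite -expnD subnKC.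
rewrite (leq_trans (split_height_bound m a b) hm) !divnMA.
by rewrite !divnMDl ?expn_gt0 // (divn_small ha) (divn_small hb) eqxx.
Qed.

Lemma split_height_cross m c d a b : a < 4 ^ m -> b < 4 ^ m ->
  c < 4 -> d < 4 -> c != d ->
  split_height m.+1 (c * 4 ^ m + a) (d * 4 ^ m + b) = m.+1.
Proof.
move=> ha hb hc hd ne; apply/eqP; rewrite eqn_leq split_height_bound andTb.
rewrite ltnNge split_height_le ?block_lt //.
by rewrite !divnMDl ?expn_gt0 // !divn_small // !addn0.
Qed.

Lemma split_height_dist m a b : a <= b -> b < 4 ^ m ->
  b - a < 4 ^ split_height m a b.
Proof.
move=> ab hb; have := leqnn (split_height m a b).
rewrite split_height_le ?(leq_ltn_trans ab hb) // => /eqP E.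
move: (split_height m a b) E => h E.
have lt : b %% 4 ^ h < 4 ^ h by rewrite ltn_pmod ?expn_gt0.
have := divn_eq a (4 ^ h); have := divn_eq b (4 ^ h); rewrite -E.
by move: (_ * _) => q; lia.
Qed.

Fixpoint chain (m a : nat) (l : seq nat) : nat :=
  if l is b :: l' then split_height m a b + chain m b l' else 0.

Lemma chain_cat m a l b r :
  chain m a (l ++ b :: r) = chain m a (rcons l b) + chain m b r.
Proof. by elim: l a => [|c l IH] a /=; rewrite ?addn0 // IH addnA. Qed.

Inductive bst : Type :=
| Empty
| Branch of bst & nat & bst.

Fixpoint keys (t : bst) : seq nat :=
  if t is Branch l s r then keys l ++ s :: keys r else [::].

Definition between (lo hi : nat) (l : seq nat) : bool :=
  sorted ltn l && all (fun k => lo <= k <= hi) l.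

Lemma between_cat lo hi l s r : between lo hi (l ++ s :: r) ->
  [/\ lo <= s <= hi, between lo s l, between s hi r,
      all (fun k => k < s) l & all (fun k => s < k) r].
Proof.
rewrite /between !(sorted_pairwise ltn_trans) pairwise_cat /= allrel_consr.
rewrite all_cat /= => /andP [/and3P [/andP [ls _] -> /andP [sr ->]] /and3P [al hs ar]].
split=> //=.
  apply/allP => k kl; rewrite (ltnW (allP ls _ kl)) andbT.
  by have /andP [] := allP al _ kl.
apply/allP => k kr; rewrite (ltnW (allP sr _ kr)) /=.
by have /andP [] := allP ar _ kr.
Qed.

Lemma size_between lo hi l : lo <= hi -> between lo hi l -> size l <= (hi - lo).+1.
Proof.
move=> lh /andP [so al].
have : {subset l <= iota lo (hi - lo).+1}.
  by move=> k /(allP al) H; rewrite mem_iota addnS subnKC // ltnS.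
by move/uniq_leq_size; rewrite size_iota; apply;
  apply: sorted_uniq so; [exact: ltn_trans | exact: ltnn].
Qed.

Fixpoint height_sum (m lo hi : nat) (t : bst) : nat :=
  if t is Branch l s r then
    minn (split_height m lo s) (split_height m s hi)
    + height_sum m lo s l + height_sum m s hi r
  else 0.

(* The split heights form an ultrametric along a sorted chain, so
   [min (d lo s) (d s hi) = d lo s + d s hi - d lo hi] and the sum telescopes. *)
Lemma height_sum_chain m lo hi t : lo <= hi -> hi < 4 ^ m -> between lo hi (keys t) ->
  height_sum m lo hi t + split_height m lo hi = chain m lo (rcons (keys t) hi).
Proof.
elim: t lo hi => [|l IHl s r IHr] lo hi lh hm /=; first by rewrite addn0.
case/between_cat => /andP [ls sh] bl br _ _.
rewrite rcons_cat rcons_cons chain_cat -IHl // ?(leq_ltn_trans sh) // -IHr //.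
by rewrite (split_height_max ls sh hm); lia.
Qed.

(** * Shape of the tree and cost of a search *)

Fixpoint steps (z : nat) (t : bst) : nat :=
  if t is Branch l s r then
    if z == s then 1 else (steps z (if z < s then l else r)).+1
  else 1.

Lemma between_mem lo hi l s r z : between lo hi (l ++ s :: r) ->
  z \in l ++ s :: r = (z == s) || (z \in if z < s then l else r).
Proof.
case/between_cat => _ _ _ /allP al /allP ar; rewrite mem_cat in_cons.
case: (ltngtP z s) => [zs|sz|->]; rewrite ?orbT ?orbF //=.
  by rewrite [z \in r](contraNF (ar z)) ?orbF // -leqNgt ltnW.
by rewrite [z \in l](contraNF (al z)) // -leqNgt ltnW.
Qed.

(* [k] counts the comparisons made so far: the first, second, third and fourth
   of each group of four take the least key, the greatest key, the first key in
   the upper half of the current cell (of [2 ^ (M - k %/ 4)] codes), and the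
   median. *)
Definition pick (M k : nat) (l : seq nat) : nat :=
  match k %% 4 with
  | 0 => 0
  | 1 => (size l).-1
  | 2 => minn (find (fun z => odd (z %/ 2 ^ (M - (k %/ 4).+1))) l) (size l).-1
  | _ => (size l)./2
  end.

Fixpoint build (M f k : nat) (l : seq nat) : bst :=
  if f is f'.+1 then
    if l is [::] then Empty else
    let i := pick M k l in
    Branch (build M f' k.+1 (take i l)) (nth 0 l i) (build M f' k.+1 (drop i.+1 l))
  else Empty.

Lemma pick_lt M k l : 0 < size l -> pick M k l < size l.
Proof.
rewrite /pick => hl; case: (k %% 4) => [//|[|[|_]]]; lia.
Qed.

Lemma keys_build M f k l : size l <= f -> keys (build M f k l) = l.
Proof.
elim: f k l => [|f IH] k l; first by rewrite leqn0 => /nilP ->.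
case: l => [//|a l] hf.
have hp := @pick_lt M k (a :: l) isT.
rewrite [build _ _ _ _]/= [keys _]/= !IH.
- by rewrite -drop_nth // cat_take_drop.
- by rewrite size_drop; move: hf hp; rewrite /=; lia.
- by rewrite size_take; move: hf hp; rewrite /=; case: ifP; lia.
Qed.

(** The remaining fuel is left unspecified because the bounds below hold for every fuel: a tree cut
    short is only searched faster. *)
Lemma steps_build M f k l z : exists f' l',
  [/\ l' = take (pick M k l) l \/ l' = drop (pick M k l).+1 l
    & steps z (build M f k l) <= (steps z (build M f' k.+1 l')).+1].
Proof.
case: f => [|f]; first by exists 0, (take (pick M k l) l); split; [left|].
case: l => [|a l]; first by exists 0, (take (pick M k [::]) [::]); split; [left|].
set l' := if z < nth 0 (a :: l) (pick M k (a :: l)) then take (pick M k (a :: l)) (a :: l)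
  else drop (pick M k (a :: l)).+1 (a :: l).
exists f, l'; split; first by rewrite /l'; case: ifP; [left|right].
rewrite [build _ f.+1 _ _]/= /steps -/steps /l'.
by case: eqP => // _; case: ifP.
Qed.

Lemma pick_median M k l : k %% 4 = 3 -> pick M k l = (size l)./2.
Proof. by rewrite /pick => ->. Qed.

(** Only the median of each group of four is sure to halve the list; [4 - k %% 4] counts the
    comparisons up to and including the next one. *)
Lemma steps_halving M f k l z t : size l < 2 ^ t ->
  steps z (build M f k l) <= 4 * t + (4 - k %% 4).
Proof.
have [n] := ubnP (4 * t + (4 - k %% 4)).
elim: n f k l t => // n IH f k l t hn hl.
case: t hn hl => [|t] hn hl.
  move: hl; rewrite expn0 ltnS leqn0 => /nilP ->.
  by case: f => [|f]; rewrite addn_gt0 subn_gt0 ltn_mod orbT.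
have [f' [l' [hl' le]]] := steps_build M f k l z.
have sl' : size l' <= size l.
  by case: hl' => ->; rewrite ?size_take ?size_drop; [case: ifP|]; lia.
apply: leq_trans le _.
have [k3|k3] := eqVneq (k %% 4) 3; last first.
  have := IH f' k.+1 l' t.+1 ltac:(lia) ltac:(lia); lia.
have : size l' < 2 ^ t.
  move: hl; rewrite expnS; case: hl' => ->; rewrite pick_median //.
    by rewrite size_take; case: ifP; lia.
  by rewrite size_drop; lia.
by move=> hs; have := IH f' k.+1 l' t ltac:(lia) hs; lia.
Qed.

(** Heights are counted here in single bits of the code, so two levels make one level of the
    quadtree. *)
Definition same_cell (h : nat) (l : seq nat) : Prop :=
  forall y z, y \in l -> z \in l -> y %/ 2 ^ h = z %/ 2 ^ h.

(** The keys are sorted and the pivot is the first one in the upper half, so the two sides of the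
    pivot lie in different halves. *)
Lemma same_cell_upper M c l l' : c < M -> sorted ltn l -> same_cell (M - c) l ->
  l' = take (pick M (4 * c).+2 l) l \/ l' = drop (pick M (4 * c).+2 l).+1 l ->
  same_cell (M - c.+1) l'.
Proof.
move=> cM so sc.
set h := M - c.+1; have hE : M - c = h.+1 by rewrite /h; lia.
set p := fun z => odd (z %/ 2 ^ h).
have pE : pick M (4 * c).+2 l = minn (find p l) (size l).-1.
  rewrite /pick; have -> : (4 * c).+2 %% 4 = 2 by lia.
  by have -> : (4 * c).+2 %/ 4 = c by lia.
have half z : z %/ 2 ^ h = 2 * (z %/ 2 ^ (M - c)) + p z.
  by rewrite hE expnSr divnMA /p; lia.
have eq_half y z : y \in l -> z \in l -> p y = p z -> y %/ 2 ^ h = z %/ 2 ^ h.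
  by move=> yl zl pz; rewrite (half y) (half z) pz (sc y z).
rewrite pE; case=> -> y z hy hz.
  have low x : x \in take (minn (find p l) (size l).-1) l -> p x = false.
    move=> xl; have xl' : x \in take (find p l) l.
      by move: xl; rewrite minnC take_min => /mem_take.
    by apply: negbTE; have := has_take_leq p (find_size p l); rewrite ltnn => /negbT;
      rewrite -all_predC => /allP /(_ _ xl').
  by apply: eq_half; rewrite ?(mem_take hy) ?(mem_take hz) // !low.
have up x : x \in drop (minn (find p l) (size l).-1).+1 l -> p x.
  (* If no key is in the upper half, the pivot is the last key and nothing remains to its right. *)
  move=> xl; have [lt|ge] := ltnP (find p l) (size l); last first.
    move: xl; rewrite drop_oversize // (minn_idPr _) //; first by case: (size l) => //=.
    by lia.
  have mE : minn (find p l) (size l).-1 = find p l by lia.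
  have xl0 := mem_drop xl.
  have fl : nth 0 l (find p l) \in l by rewrite mem_nth.
  have pf : p (nth 0 l (find p l)) by rewrite nth_find // has_find.
  have le : nth 0 l (find p l) < x.
    have := so; rewrite -{1}(cat_take_drop (find p l) l) (drop_nth 0) //.
    rewrite (sorted_pairwise ltn_trans) pairwise_cat /= => /and3P [_ _ /andP [/allP lx _]].
    by apply: lx; rewrite -mE.
  have := leq_div2r (2 ^ h) (ltnW le); rewrite (half x) (half (nth 0 l _)).
  by rewrite (sc _ _ fl xl0) pf; case: (p x) => //; lia.
by apply: eq_half; rewrite ?(mem_drop hy) ?(mem_drop hz) // !up.
Qed.

Lemma pick_min M c l : pick M (4 * c) l = 0.
Proof. by rewrite /pick modnMr. Qed.

Lemma pick_max M c l : pick M (4 * c).+1 l = (size l).-1.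
Proof. by rewrite /pick; have -> : (4 * c).+1 %% 4 = 1 by lia. Qed.

Lemma steps_nil M f k z : steps z (build M f k [::]) = 1.
Proof. by case: f. Qed.

(** The first comparison is with the least key, whose left subtree is empty. *)
Lemma steps_below M f c l z : (forall y, y \in l -> z < y) ->
  steps z (build M f (4 * c) l) <= 2.
Proof.
case: f => [//|f]; case: l => [//|a l] H.
rewrite [build _ _ _ _]/= pick_min /steps -/steps /=.
rewrite H ?mem_head // steps_nil.
by case: eqP.
Qed.

(** After the least key comes the greatest, whose right subtree is empty. *)
Lemma steps_above M f c l z : (forall y, y \in l -> y < z) ->
  steps z (build M f (4 * c) l) <= 3.
Proof.
case: f => [//|f]; case: l => [//|a l] H.
rewrite [build _ _ _ _]/= pick_min /steps -/steps.
have az : a < z by apply: H; rewrite mem_head.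
rewrite [nth _ _ _]/= (gtn_eqF az) [z < a]ltnNge (ltnW az) [~~ true]/= ltnS [drop _ _]/= drop0.
case: f => [//|f]; case: l H => [//|b l] H.
rewrite [build _ _ _ _]/= pick_max /steps -/steps.
have lz : nth 0 (b :: l) (size (b :: l)).-1 < z.
  by apply: H; rewrite in_cons mem_nth ?orbT //=.
by rewrite (gtn_eqF lz) [z < _]ltnNge (ltnW lz) [~~ true]/= drop_oversize ?steps_nil.
Qed.

(** Each round of four halves the common cell. At depth [I] either all keys lie in the cell of [z]
    and the medians finish, or [z] lies to one side of all keys and the extreme keys end the
    search. *)
Lemma steps_level M f c l z I t : c <= I -> I <= M -> sorted ltn l ->
  same_cell (M - c) l ->
  count (fun y => y %/ 2 ^ (M - I) == z %/ 2 ^ (M - I)) l < 2 ^ t ->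
  steps z (build M f (4 * c) l) <= 4 * (I - c) + 4 * t + 4.
Proof.
move=> cI IM so sc ct; have [n] := ubnP (I - c).
elim: n f c l cI so sc ct => // n IH f c l cI so sc ct hn.
have [ltc|gec] := ltnP c I; last first.
  have E : c = I by lia.
  rewrite {c cI gec hn}E in sc *.
  have [al|/allPn [y yl ny]] := boolP (all (fun y => y %/ 2 ^ (M - I) == z %/ 2 ^ (M - I)) l).
    have hs : size l < 2 ^ t by move: al ct; rewrite all_count => /eqP ->.
    by have := steps_halving M f (4 * I) z hs; rewrite modnMr; lia.
  have nyz : y %/ 2 ^ (M - I) <> z %/ 2 ^ (M - I) by apply/eqP.
  have [zy|yz] := ltnP z y.
    suff : steps z (build M f (4 * I) l) <= 2 by lia.
    apply: steps_below => x xl; rewrite ltnNge; apply/negP => /(leq_div2r (2 ^ (M - I))).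
    by have := leq_div2r (2 ^ (M - I)) (ltnW zy); rewrite (sc x y xl yl); lia.
  suff : steps z (build M f (4 * I) l) <= 3 by lia.
  apply: steps_above => x xl; rewrite ltnNge; apply/negP => /(leq_div2r (2 ^ (M - I))).
  by have := leq_div2r (2 ^ (M - I)) yz; rewrite (sc x y xl yl); lia.
have sub k l1 l2 : l2 = take (pick M k l1) l1 \/ l2 = drop (pick M k l1).+1 l1 ->
  subseq l2 l1.
  by case=> ->; rewrite ?take_subseq ?drop_subseq.
have [f1 [l1 [/sub s1 b1]]] := steps_build M f (4 * c) l z.
have [f2 [l2 [/sub s2 b2]]] := steps_build M f1 (4 * c).+1 l1 z.
have [f3 [l3 [e3 b3]]] := steps_build M f2 (4 * c).+2 l2 z.
have [f4 [l4 [/sub s4 b4]]] := steps_build M f3 (4 * c).+3 l3 z.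
have s20 := subseq_trans s2 s1.
have s43 := subseq_trans s4 (sub _ _ _ e3).
have s40 := subseq_trans s43 s20.
have c3 : same_cell (M - c.+1) l3.
  apply: same_cell_upper e3; first by lia.
    by apply: subseq_sorted s20 so; exact: ltn_trans.
  by move=> x y xl yl; apply: sc; apply: (mem_subseq s20).
have cE : (4 * c).+4 = 4 * c.+1 by lia.
rewrite cE in b4.
suff : steps z (build M f4 (4 * c.+1) l4) <= 4 * (I - c.+1) + 4 * t + 4 by lia.
apply: IH => //; last by lia.
- by apply: subseq_sorted s40 so; exact: ltn_trans.
- by move=> x y xl yl; apply: c3; apply: (mem_subseq s4).
- exact: leq_ltn_trans (leq_count_subseq _ s40) ct.
Qed.

(** * Bit encoding of a search tree *)

Lemma mixed_radix_lt a A b B : a < A -> b < B -> a + A * b < A * B.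
Proof.
move=> ha hb; apply: leq_trans (_ : A * b.+1 <= _); first by rewrite mulnS; lia.
by rewrite leq_mul2l hb orbT.
Qed.

Lemma modn_mul_split x a b : x %% (a * b) = x %% a + a * (x %/ a %% b).
Proof.
have [->|a0] := posnP a; first by rewrite !mul0n !modn0 addn0.
have [->|b0] := posnP b; first by rewrite muln0 !modn0 addnC mulnC -divn_eq.
rewrite {1}(divn_eq x a) {1}(divn_eq (x %/ a) b) mulnDl -mulnA (mulnC b) -addnA.
rewrite modnMDl modn_small; first by rewrite addnC (mulnC _ a).
by rewrite addnC (mulnC _ a) mixed_radix_lt ?ltn_pmod.
Qed.

Lemma modn_low x a b u v : u < a -> x %% (a * b) = u + a * v ->
  x %% a = u /\ x %/ a %% b = v.
Proof.
rewrite modn_mul_split => ua E; have a0 : 0 < a by apply: leq_ltn_trans ua.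
have E1 : x %% a = u.
  move: E => /(congr1 (modn^~ a)) /=.
  by rewrite ![_ + a * _]addnC ![a * _]mulnC !modnMDl modn_mod (modn_small ua).
split=> //; move: E; rewrite E1 => /eqP; rewrite eqn_add2l eqn_mul2l => /orP [/eqP E0|/eqP //].
by rewrite E0 in a0.
Qed.

(** A window of [w] bits is the upper part of one word joined to the lower part of the next. For
    aligned [A] the second word is shifted by [w] and vanishes. *)
Lemma read_unaligned V w A : 0 < w ->
  (V %/ 2 ^ (A %/ w * w) %% 2 ^ w) %/ 2 ^ (A %% w)
  + (V %/ 2 ^ ((A %/ w).+1 * w) %% 2 ^ w * 2 ^ (w - A %% w)) %% 2 ^ w
  = V %/ 2 ^ A %% 2 ^ w.
Proof.
move=> w0; have rw : A %% w < w by rewrite ltn_mod.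
have E2 : V %/ 2 ^ ((A %/ w).+1 * w) = V %/ 2 ^ (A %/ w * w) %/ 2 ^ w.
  by rewrite mulSn addnC expnD divnMA.
have E1 : V %/ 2 ^ A = V %/ 2 ^ (A %/ w * w) %/ 2 ^ (A %% w).
  by rewrite {1}(divn_eq A w) expnD divnMA.
rewrite E2 E1; move: (V %/ _) (A %% w) rw => U r rw.
have W : 2 ^ w = 2 ^ (w - r) * 2 ^ r by rewrite -expnD subnK // ltnW.
have W' : 2 ^ w = 2 ^ r * 2 ^ (w - r) by rewrite mulnC.
have p k : 0 < 2 ^ k by rewrite expn_gt0.
have -> : U %% 2 ^ w %/ 2 ^ r = U %/ 2 ^ r %% 2 ^ (w - r).
  rewrite W' modn_mul_split addnC mulnC divnMDl // (divn_small (ltn_pmod _ _)) //.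
  by rewrite addn0.
have -> : (U %/ 2 ^ w %% 2 ^ w * 2 ^ (w - r)) %% 2 ^ w = 2 ^ (w - r) * (U %/ 2 ^ w %% 2 ^ r).
  rewrite [X in _ %% X]W mulnC -muln_modr; congr (_ * _).
  by rewrite [X in U %/ _ %% X]W' modn_mul_split -modnDmr mulnC modnMl addn0 modn_mod.
by rewrite [in X in _ = X]W modn_mul_split -divnMA -W'.
Qed.

(** Subtracting 1 flips exactly the trailing zeros and the lowest 1. *)
Lemma lxor_pred e r : Nat.lxor (2 ^ e * (1 + 2 * r)) (2 ^ e * (1 + 2 * r) - 1) = 2 ^ e.+1 - 1.
Proof.
elim: e => [|e IH].
  have -> : 2 ^ 0 * (1 + 2 * r) = 2 * r + true by rewrite expn0; lia.
  have -> : 2 * r + true - 1 = 2 * r + false by lia.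
  by rewrite lxor_bit Nat.lxor_nilpotent.
have p : 0 < 2 ^ e by rewrite expn_gt0.
rewrite expnS -mulnA.
set B := 2 ^ e * _ in IH *.
have B0 : 0 < B by rewrite muln_gt0 p.
have -> : 2 * B - 1 = 2 * (B - 1) + true by lia.
have -> : 2 * B = 2 * B + false by rewrite addn0.
rewrite lxor_bit IH !expnS; lia.
Qed.

(** Seven digits of [h + 6] bits (the zeros, two coordinates, the record length, three for the skip)
    and three single bits. The 6 makes the record length itself fit in one digit. *)
Definition record_bits (h : nat) : nat := 7 * (h + 6) + 3.

(* The bits are, from the lowest: 1 for a nonempty tree, [d], then [h + 6] zeros and
   a 1, and fields in base [G = 2 ^ (h + 6)], the last of three digits: the low
   bits of the two coordinates, the length of this record and the length [far] to
   skip.  The lone 1 makes [G] readable in constant time: above the first two bits,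
   [x xor (x - 1) = 2 * G - 1]. *)
Definition record (m h : nat) (d : bool) (s far : nat) : nat :=
  let G := 2 ^ (h + 6) in
  1 + 2 * d + 4 * (G * (1 + 2 * (xcoord m s %% G + G * (ycoord m s %% G
    + G * (record_bits h + G * (far %% G ^ 3)))))).

Lemma record_bits_lt h : record_bits h < 2 ^ (h + 6).
Proof.
rewrite /record_bits; elim: h => [//|h IH].
by rewrite addSn expnS; lia.
Qed.

Lemma record_bitsE h : 2 ^ record_bits h = 8 * (2 ^ (h + 6)) ^ 7.
Proof. by rewrite /record_bits expnD mulnC -expnM (mulnC 7). Qed.

Lemma record_lt m h d s far : record m h d s far < 2 ^ record_bits h.
Proof.
rewrite record_bitsE /record; set G := 2 ^ (h + 6).
have G0 : 0 < G by rewrite expn_gt0.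
have : xcoord m s %% G + G * (ycoord m s %% G + G * (record_bits h + G * (far %% G ^ 3)))
   < G * (G * (G * G ^ 3)).
  have l3 : far %% G ^ 3 < G ^ 3 by rewrite ltn_mod expn_gt0 G0.
  have rl : record_bits h < G := record_bits_lt h.
  by do !apply: mixed_radix_lt; rewrite ?(ltn_pmod _ G0).
have -> : G ^ 7 = G * (G * (G * (G * G ^ 3))) by rewrite -!expnS.
move: (xcoord _ _ %% G + _) (G * (G * (G * G ^ 3))) => R Q hR.
have : G * (1 + 2 * R) + G <= G * (2 * Q) by rewrite -mulnSr leq_mul2l; lia.
by rewrite mulnCA; case: d; lia.
Qed.

(** An empty subtree is a single 0 bit, told apart from a record by the lowest bit. *)
Fixpoint tree_bits (m lo hi : nat) (t : bst) : nat :=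
  if t is Branch l s r then
    record_bits (minn (split_height m lo s) (split_height m s hi))
    + (tree_bits m lo s l + tree_bits m s hi r)
  else 1.

(* The bit [d] of a record tells which of its two bounds shares the longer
   prefix with its key; the subtree on that side comes first. *)
Fixpoint tree_code (m lo hi : nat) (t : bst) : nat :=
  if t is Branch l s r then
    let h := minn (split_height m lo s) (split_height m s hi) in
    let L := tree_bits m lo s l in
    let R := tree_bits m s hi r in
    if split_height m s hi < split_height m lo s then
      record m h true s R + 2 ^ record_bits h *
        (tree_code m s hi r + 2 ^ R * tree_code m lo s l)
    else
      record m h false s L + 2 ^ record_bits h *
        (tree_code m lo s l + 2 ^ L * tree_code m s hi r)
  else 0.

Lemma tree_code_lt m lo hi t : tree_code m lo hi t < 2 ^ tree_bits m lo hi t.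
Proof.
elim: t lo hi => [//|l IHl s r IHr] lo hi /=.
case: ifP => _; rewrite (expnD _ (record_bits _)) (expnD _ (tree_bits _ _ _ _)).
  rewrite (mulnC (2 ^ tree_bits m lo s l)).
  by apply: mixed_radix_lt; [exact: record_lt | apply: mixed_radix_lt].
by apply: mixed_radix_lt; [exact: record_lt | apply: mixed_radix_lt].
Qed.

(** A record takes [7 * h + 45] bits, and [n] keys leave [n + 1] empty subtrees of one bit each. *)
Lemma tree_bits_sum m lo hi t :
  tree_bits m lo hi t = 7 * height_sum m lo hi t + 46 * size (keys t) + 1.
Proof.
elim: t lo hi => [//|l IHl s r IHr] lo hi /=.
by rewrite IHl IHr size_cat /= /record_bits; lia.
Qed.

Lemma height_sum_le m lo hi t h : lo <= hi -> hi < 4 ^ m -> between lo hi (keys t) ->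
  split_height m lo hi <= h -> height_sum m lo hi t <= h * size (keys t).
Proof.
elim: t lo hi => [|l IHl s r IHr] lo hi lh hm //= b.
have [/andP [ls sh] bl br _ _] := between_cat b.
rewrite (split_height_max ls sh hm) geq_max => /andP [h1 h2].
have := IHl lo s ls (leq_ltn_trans sh hm) bl h1; have := IHr s hi sh hm br h2.
rewrite size_cat /=.
by move: (minn _ _) (geq_minl (split_height m lo s) (split_height m s hi)); lia.
Qed.

(** Makes the skip length fit in three digits: a cell of height [h] has at most [4 ^ h] keys, and
    each contributes at most [7 * h + 46 <= 2 ^ (h + 6)] bits. *)
Lemma tree_bits_lt m lo hi t h : lo <= hi -> hi < 4 ^ m -> between lo hi (keys t) ->
  split_height m lo hi <= h -> tree_bits m lo hi t < 2 ^ (3 * (h + 6)).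
Proof.
move=> lh hm b hh; rewrite tree_bits_sum.
have := height_sum_le lh hm b hh; have := size_between lh b.
have := split_height_dist lh hm.
have := leq_pexp2l (isT : 0 < 4) hh.
have -> : 2 ^ (3 * (h + 6)) = 4 ^ h * 2 ^ (h + 6) * 4 ^ 6.
  by rewrite (_ : 4 = 2 ^ 2) // -!expnM -!expnD; congr (_ ^ _); lia.
have := record_bits_lt h; rewrite /record_bits.
move: (size _) (height_sum _ _ _ _) (2 ^ _) (4 ^ split_height _ _ _) (4 ^ h).
move=> n S G D F hG hD hd hn hS.
have nF : n <= F by lia.
have : 7 * S + 46 * n <= G * F.
  by apply: leq_trans (_ : (7 * h + 46) * F <= _); [nia | rewrite leq_mul2r; lia].
have : 0 < G * F by rewrite muln_gt0; lia.
rewrite (mulnC F); move: (G * F) => Q Q0 hQ.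
apply: (@leq_ltn_trans (Q + 1)); first by lia.
by apply: (@leq_trans (Q * 4)); [lia | rewrite leq_mul2l orbC].
Qed.

(** * The search program *)

Definition block (l : seq instr) : prog := foldr (fun i p => PSeq (PInstr i) p) PSkip l.

(* [e] lists the contents of the first registers; the others are unconstrained. *)
Definition in_state (w : nat) (M : word w -> word w) (e : seq nat) (s : state w) : Prop :=
  memory s = M /\ forall r, r < size e -> regs s r = nth 0 e r :> nat.

Definition nat_op (w : nat) (o : binop) (a b : nat) : nat :=
  match o with
  | OpAdd => a + b
  | OpSub => a + 2 ^ w - b
  | OpMul => a * b
  | OpDiv => a %/ b
  | OpMod => a %% b
  | OpAnd => Nat.land a b
  | OpOr => Nat.lor a b
  | OpXor => Nat.lxor a b
  | OpShl => a * 2 ^ b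
  | OpShr => a %/ 2 ^ b
  | OpEq => (a == b)%N
  | OpLt => (a < b)%N
  end.

(** A Hoare triple for total correctness with exact running time [t]; the memory is a parameter
    common to both ends. *)
Definition triple (w : nat) (M : word w -> word w) (e : seq nat) (p : prog)
    (t : nat) (e' : seq nat) : Prop :=
  forall s, in_state M e s -> exists s', exec p s t s' /\ in_state M e' s'.

Lemma triple_seq w (M : word w -> word w) e1 e2 e3 p q t1 t2 :
  triple M e1 p t1 e2 -> triple M e2 q t2 e3 ->
  triple M e1 (PSeq p q) (t1 + t2) e3.
Proof.
move=> hp hq s1 /hp [s2 [ex1 /hq [s3 [ex2 hs]]]].
by exists s3; split=> //; apply: ExecSeq ex1 ex2.
Qed.

Lemma triple_if_true w (M : word w -> word w) e e' r p q t :
  r < size e -> nth 0 e r != 0 -> triple M e p t e' ->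
  triple M e (PIf r p q) t.+1 e'.
Proof.
move=> hr h0 hp s hs; have [s' [ex hs']] := hp s hs.
by exists s'; split=> //; apply: ExecIfTrue ex; rewrite (proj2 hs).
Qed.

Lemma triple_if_false w (M : word w -> word w) e e' r p q t :
  r < size e -> nth 0 e r = 0 -> triple M e q t e' ->
  triple M e (PIf r p q) t.+1 e'.
Proof.
move=> hr h0 hp s hs; have [s' [ex hs']] := hp s hs.
by exists s'; split=> //; apply: ExecIfFalse ex; rewrite (proj2 hs).
Qed.

Definition runs (w : nat) (M : word w -> word w) (e : seq nat) (l : seq instr)
    (e' : seq nat) : Prop :=
  triple M e (block l) (size l).+1 e'.

Lemma in_state_cat w (M : word w -> word w) e t s :
  in_state M (e ++ t) s -> in_state M e s.
Proof.
case=> hM hs; split=> // r hr.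
by rewrite hs ?size_cat ?nth_cat ?hr // ltn_addr.
Qed.

Lemma runs_nil w (M : word w -> word w) e t : runs M (e ++ t) [::] e.
Proof. by move=> s /in_state_cat hs; exists s; split=> //; exact: ExecSkip. Qed.

(** Lets a block use [n] scratch registers with arbitrary initial contents; [runs_nil] forgets them
    again. *)
Lemma runs_temporaries w (M : word w -> word w) n e l e' :
  (forall t, size t = n -> runs M (e ++ t) l e') -> runs M e l e'.
Proof.
move=> H s [hM hs].
apply: (H (mkseq (fun i => regs s (size e + i) : nat) n) (size_mkseq _ _)).
split=> // r; rewrite size_cat size_mkseq nth_cat => hr.
case: ltnP => [|le]; first exact: hs.
by rewrite nth_mkseq ?subnKC // ltn_subLR.
Qed.

Lemma runs_cons w (M : word w -> word w) e e1 e' i l :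
  (forall s, in_state M e s -> in_state M e1 (instr_sem i s)) ->
  runs M e1 l e' -> runs M e (i :: l) e'.
Proof.
move=> hi hl s hs; have [s' [ex hs']] := hl _ (hi s hs).
exists s'; split=> //; rewrite /= -add1n.
by apply: ExecSeq ex; exact: ExecInstr.
Qed.

Lemma runs_op w (M : word w -> word w) e e' o r a b v l :
  [&& r < size e, a < size e & b < size e] ->
  nat_op w o (nth 0 e a) (nth 0 e b) %% 2 ^ w = v ->
  runs M (set_nth 0 e r v) l e' -> runs M e (IOp o r a b :: l) e'.
Proof.
case/and3P=> hr ha hb hv; apply: runs_cons => s [hM hs]; split=> // r' /=.
rewrite size_set_nth (maxn_idPr hr) => hr'.
rewrite /upd nth_set_nth /=; case: eqP => // _; last exact: hs.
by rewrite -hv /nat_op -!hs //; case: o hv.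
Qed.

Lemma runs_const w (M : word w -> word w) e e' r n l :
  r < size e -> n < 2 ^ w ->
  runs M (set_nth 0 e r n) l e' -> runs M e (IConst r n :: l) e'.
Proof.
move=> hr hv; apply: runs_cons => s [hM hs]; split=> // r' /=.
rewrite size_set_nth (maxn_idPr hr) => hr'.
by rewrite /upd nth_set_nth /=; case: eqP => //= _; rewrite ?modn_small // hs.
Qed.

Lemma runs_load w (M : word w -> word w) e e' r a v l :
  (r < size e) && (a < size e) ->
  M (to_word w (nth 0 e a)) = v :> nat ->
  runs M (set_nth 0 e r v) l e' -> runs M e (ILoad r a :: l) e'.
Proof.
case/andP=> hr ha hv; apply: runs_cons => s [hM hs]; split=> // r' /=.
rewrite size_set_nth (maxn_idPr hr) => hr'.
rewrite /upd nth_set_nth /=; case: eqP => // _; last exact: hs.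
rewrite hM -hv; congr (nat_of_ord (M _)); apply: val_inj => /=.
by rewrite -hs // modn_small // ltn_ord.
Qed.

Ltac op v :=
  apply: (@runs_op _ _ _ _ _ _ _ _ v);
  [by [] | cbn [nth nat_op] | cbn [set_nth]].

Ltac small := rewrite modn_small //.

(** Registers: 0 and 1 query, 2 word length, 3 bit address, 4 to 7 coordinates of [lo] and [hi], 8
    loop flag, 9 answer, 10 and 12 the constants 1 and 2, 13 the window read. This block puts [G]
    into 14, [d] into 16, the key bits into 17 and 18, the record length into 19 and the skip into
    20. *)
Definition fields_block : seq instr :=
  [:: IOp OpDiv 15 13 12; IOp OpMod 16 15 12; IOp OpDiv 15 15 12;
      IOp OpSub 14 15 10; IOp OpXor 14 15 14; IOp OpAdd 14 14 10;
      IOp OpDiv 15 15 14; IOp OpDiv 14 14 12;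
      IOp OpMod 17 15 14; IOp OpDiv 15 15 14;
      IOp OpMod 18 15 14; IOp OpDiv 15 15 14;
      IOp OpMod 19 15 14; IOp OpDiv 15 15 14;
      IOp OpMul 20 14 14; IOp OpMul 20 20 14; IOp OpMod 20 15 20].

(** [X] is a whole window, so [Y] stands for the bits behind the record; the last reduction modulo
    [G ^ 3] removes them. *)
Lemma runs_fields w (M : word w -> word w) x y A lox loy hix hiy r8 r9 r11 r14 X
    (d : bool) e sx sy len far Y :
  let G := 2 ^ e in
  X = 1 + 2 * d + 4 * (G * (1 + 2 * (sx + G * (sy + G * (len + G * (far + G ^ 3 * Y)))))) ->
  X < 2 ^ w -> sx < G -> sy < G -> len < G -> far < G ^ 3 -> G ^ 3 < 2 ^ w -> 1 < G ->
  runs M [:: x; y; w; A; lox; loy; hix; hiy; r8; r9; 1; r11; 2; X; r14]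
    fields_block
    [:: x; y; w; A; lox; loy; hix; hiy; r8; r9; 1; r11; 2; X; G; far + G ^ 3 * Y;
        d : nat; sx; sy; len; far].
Proof.
move=> G XE Xw hsx hsy hlen hfar G3w G1; rewrite /fields_block.
have G2w : G * G < 2 ^ w.
  by apply: leq_trans G3w; rewrite ltnS !expnS expn0 muln1 mulnA leq_pmulr //; lia.
have divG a b : a < G -> (a + G * b) %/ G = b.
  by move=> ha; rewrite addnC mulnC divnMDl ?divn_small ?addn0 //; lia.
have modG a b : a < G -> (a + G * b) %% G = a.
  by move=> ha; rewrite addnC mulnC modnMDl modn_small.
set R3 := far + _ in XE *; set R2 := len + G * R3 in XE; set R1 := sy + G * R2 in XE.
set R := sx + G * R1 in XE.
have R3R2 : R3 <= R2 by rewrite /R2; nia.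
have R2R1 : R2 <= R1 by rewrite /R1; nia.
have R1R : R1 <= R by rewrite /R; nia.
set x4 := G * (1 + 2 * R) in XE.
have x40 : 0 < x4 by rewrite muln_gt0; lia.
have Rx4 : 2 * R < x4 by rewrite /x4; nia.
have d1 : d <= 1 by case: (d).
apply: (@runs_temporaries _ _ 6) => -[|u0 [|u1 [|u2 [|u3 [|u4 [|u5 [|]]]]]]] // _; cbn [cat].
op (d + 2 * x4); first by small; lia.
op (d : nat); first by small; lia.
op x4; first by small; lia.
op (x4 - 1).
  have -> : x4 + 2 ^ w - 1 = x4 - 1 + 2 ^ w by lia.
  by rewrite modnDr; small; lia.
op (2 * G - 1).
  by rewrite lxor_pred expnS; small; nia.
op (2 * G); first by small; nia.
(* Dividing by [2 * G] drops the zeros together with the lone 1. *)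
op R.
  rewrite /x4 [2 * G]mulnC divnMA mulKn; last by lia.
  by small; lia.
op G; first by small; lia.
op sx; first by rewrite modG //; small; lia.
op R1; first by rewrite divG //; small; lia.
op sy; first by rewrite modG //; small; lia.
op R2; first by rewrite divG //; small; lia.
op len; first by rewrite modG //; small; lia.
op R3; first by rewrite divG //; small; lia.
op (G * G); first by small.
op (G ^ 3).
  have -> : G * G * G = G ^ 3 by rewrite !expnS expn0 muln1 mulnA.
  by small.
op far.
  rewrite /R3 addnC mulnC modnMDl [in X in X %% _]modn_small //.
  by small; lia.
exact: (@runs_nil _ _ [:: _; _; _; _; _; _; _; _; _; _; _; _; _; _; _; _; _; _; _; _; _]).
Qed.

(** Completes the key by the high coordinate bits of the closer bound, selected without a branch
    through multiplication by [d] and [1 - d]. *)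
Definition base_block : seq instr :=
  [:: IOp OpSub 21 10 16;
      IOp OpMul 15 21 4; IOp OpMul 22 16 6; IOp OpAdd 15 15 22;
      IOp OpDiv 15 15 14; IOp OpMul 15 15 14; IOp OpAdd 17 15 17;
      IOp OpMul 15 21 5; IOp OpMul 22 16 7; IOp OpAdd 15 15 22;
      IOp OpDiv 15 15 14; IOp OpMul 15 15 14; IOp OpAdd 18 15 18].

Lemma word_not w (b : bool) : 0 < w -> (1 + 2 ^ w - b) %% 2 ^ w = ~~ b.
Proof.
case: w => // w _; have : 0 < 2 ^ w by rewrite expn_gt0.
case: b => p; first by rewrite add1n subn1 /= modnn.
by rewrite subn0 modnDr modn_small // expnS; lia.
Qed.

Lemma runs_base w (M : word w -> word w) x y A lox loy hix hiy r8 r9 r11 r13 r15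
    (d : bool) G sx sy sx' sy' r19 r20 :
  0 < w -> lox < 2 ^ w -> loy < 2 ^ w -> hix < 2 ^ w -> hiy < 2 ^ w ->
  (if d then hix else lox) %/ G * G + sx = sx' ->
  (if d then hiy else loy) %/ G * G + sy = sy' ->
  sx' < 2 ^ w -> sy' < 2 ^ w ->
  runs M [:: x; y; w; A; lox; loy; hix; hiy; r8; r9; 1; r11; 2; r13; G; r15;
             d : nat; sx; sy; r19; r20]
    base_block
    [:: x; y; w; A; lox; loy; hix; hiy; r8; r9; 1; r11; 2; r13; G;
        (if d then hiy else loy) %/ G * G; d : nat; sx'; sy'; r19; r20].
Proof.
move=> w0 lx ly hx hy Ex Ey wx wy; rewrite /base_block.
have W : 0 < 2 ^ w by rewrite expn_gt0.
have floor u : u %/ G * G <= u := leq_divM u G.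
apply: (@runs_temporaries _ _ 2) => -[|u0 [|u1 [|]]] // _; cbn [cat].
op (~~ d : nat); first exact: word_not.
op (~~ d * lox); first by small; case: (d) => /=; lia.
op (d * hix); first by small; case: (d) => /=; lia.
op (if d then hix else lox); first by small; case: (d) => /=; lia.
op ((if d then hix else lox) %/ G).
  by small; apply: leq_ltn_trans (leq_div _ _) _; case: (d).
op ((if d then hix else lox) %/ G * G).
  by small; apply: leq_ltn_trans (floor _) _; case: (d).
op sx'; first by rewrite Ex; small.
op (~~ d * loy); first by small; case: (d) => /=; lia.
op (d * hiy); first by small; case: (d) => /=; lia.
op (if d then hiy else loy); first by small; case: (d) => /=; lia.
op ((if d then hiy else loy) %/ G).
  by small; apply: leq_ltn_trans (leq_div _ _) _; case: (d).
op ((if d then hiy else loy) %/ G * G).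
  by small; apply: leq_ltn_trans (floor _) _; case: (d).
op sy'; first by rewrite Ey; small.
exact: (@runs_nil _ _ [:: _; _; _; _; _; _; _; _; _; _; _; _; _; _; _; _; _; _; _; _; _]).
Qed.

Lemma lxor_lt a b w : a < 2 ^ w -> b < 2 ^ w -> Nat.lxor a b < 2 ^ w.
Proof.
elim: w a b => [|w IH] a b.
  by rewrite expn0 !ltnS !leqn0 => /eqP -> /eqP ->.
rewrite expnS -(odd_double_half a) -(odd_double_half b) -!mul2n ![odd _ + _]addnC => ha hb.
have := IH a./2 b./2 ltac:(lia) ltac:(lia).
by rewrite lxor_bit; case: (_ (+) _); lia.
Qed.

Definition compare_block : seq instr :=
  [:: IOp OpXor 14 0 17; IOp OpXor 15 1 18; IOp OpLt 21 14 15;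
      IOp OpXor 15 14 15; IOp OpLt 14 14 15; IOp OpMul 21 21 14;
      IOp OpLt 14 0 17; IOp OpLt 15 1 18; IOp OpMul 15 21 15;
      IOp OpSub 22 10 21; IOp OpMul 14 22 14; IOp OpAdd 14 14 15;
      IOp OpEq 15 0 17; IOp OpEq 21 1 18; IOp OpMul 15 15 21;
      IOp OpMul 9 15 10; IOp OpSub 8 10 15].

Lemma runs_compare w (M : word w -> word w) x y A lox loy hix hiy r8 r9 r11 r13 r14 r15
    r16 sx sy r19 r20 :
  0 < w -> x < 2 ^ w -> y < 2 ^ w -> sx < 2 ^ w -> sy < 2 ^ w ->
  let eq := (x == sx) && (y == sy) in
  runs M [:: x; y; w; A; lox; loy; hix; hiy; r8; r9; 1; r11; 2; r13; r14; r15;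
             r16; sx; sy; r19; r20]
    compare_block
    [:: x; y; w; A; lox; loy; hix; hiy; ~~ eq : nat; eq : nat; 1; r11; 2; r13;
        zless x y sx sy : nat; eq : nat; r16; sx; sy; r19; r20].
Proof.
move=> w0 hx hy hsx hsy eq; rewrite /compare_block.
have bit (b : bool) : b < 2 ^ w.
  by apply: leq_ltn_trans (leq_b1 b) _; rewrite -{1}(expn0 2) ltn_exp2l.
have bit_mul (b c : bool) : (b * c) %% 2 ^ w = (b && c : bool).
  by rewrite mulnb modn_small.
apply: (@runs_temporaries _ _ 2) => -[|u0 [|u1 [|]]] // _; cbn [cat].
set dx := Nat.lxor x sx; set dy := Nat.lxor y sy.
op dx; first by small; exact: lxor_lt.
op dy; first by small; exact: lxor_lt.
op (dx < dy : nat); first by small.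
op (Nat.lxor dx dy); first by small; do 3!apply: lxor_lt => //.
op (dx < Nat.lxor dx dy : nat); first by small.
set lm := (dx < dy) && (dx < Nat.lxor dx dy).
op (lm : nat); first exact: bit_mul.
op (x < sx : nat); first by small.
op (y < sy : nat); first by small.
op (lm && (y < sy) : nat); first exact: bit_mul.
op (~~ lm : nat); first exact: word_not.
op (~~ lm && (x < sx) : nat); first exact: bit_mul.
op (zless x y sx sy : nat).
  have -> : zless x y sx sy = if lm then y < sy else x < sx by [].
  by case: (lm); rewrite /= ?addn0 ?add0n; small.
op (x == sx : nat); first by small.
op (y == sy : nat); first by small.
op (eq : nat); first exact: bit_mul.
op (eq : nat); first by rewrite muln1; small.
op (~~ eq : nat); first exact: word_not.
exact: (@runs_nil _ _ [:: _; _; _; _; _; _; _; _; _; _; _; _; _; _; _; _; _; _; _; _; _]).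
Qed.

(** The subtree stored first is the right one iff [d = 1], so the query goes to the second one, and
    the skip is added, exactly when [lt == d]. *)
Definition update_block : seq instr :=
  [:: IOp OpEq 15 14 16; IOp OpMul 15 15 20; IOp OpAdd 3 3 19; IOp OpAdd 3 3 15;
      IOp OpSub 21 10 14;
      IOp OpMul 15 14 4; IOp OpMul 22 21 17; IOp OpAdd 4 15 22;
      IOp OpMul 15 14 5; IOp OpMul 22 21 18; IOp OpAdd 5 15 22;
      IOp OpMul 15 14 17; IOp OpMul 22 21 6; IOp OpAdd 6 15 22;
      IOp OpMul 15 14 18; IOp OpMul 22 21 7; IOp OpAdd 7 15 22].

Lemma runs_update w (M : word w -> word w) x y A lox loy hix hiy r8 r9 r11 r13 r15
    (lt d : bool) sx sy len far :
  0 < w -> lox < 2 ^ w -> loy < 2 ^ w -> hix < 2 ^ w -> hiy < 2 ^ w ->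
  sx < 2 ^ w -> sy < 2 ^ w -> A + len + far < 2 ^ w ->
  runs M [:: x; y; w; A; lox; loy; hix; hiy; r8; r9; 1; r11; 2; r13; lt : nat; r15;
             d : nat; sx; sy; len; far]
    update_block
    [:: x; y; w; A + len + (lt == d) * far;
        if lt then lox else sx; if lt then loy else sy;
        if lt then sx else hix; if lt then sy else hiy; r8; r9; 1; r11; 2].
Proof.
move=> w0 lx ly hx hy wx wy hA; rewrite /update_block.
have bit (b : bool) : b < 2 ^ w.
  by apply: leq_ltn_trans (leq_b1 b) _; rewrite -{1}(expn0 2) ltn_exp2l.
apply: (@runs_temporaries _ _ 2) => -[|u0 [|u1 [|]]] // _; cbn [cat].
op (lt == d : nat).
  have -> : ((lt : nat) == d) = (lt == d) by case: (lt); case: (d).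
  by small.
op ((lt == d) * far); first by small; case: eqP => _; lia.
op (A + len); first by small; lia.
op (A + len + (lt == d) * far); first by small; case: eqP => _; lia.
op (~~ lt : nat); first exact: word_not.
op (lt * lox); first by small; case: (lt); lia.
op (~~ lt * sx); first by small; case: (lt) => /=; lia.
op (if lt then lox else sx); first by small; case: (lt) => /=; lia.
op (lt * loy); first by small; case: (lt); lia.
op (~~ lt * sy); first by small; case: (lt) => /=; lia.
op (if lt then loy else sy); first by small; case: (lt) => /=; lia.
op (lt * sx); first by small; case: (lt); lia.
op (~~ lt * hix); first by small; case: (lt) => /=; lia.
op (if lt then sx else hix); first by small; case: (lt) => /=; lia.
op (lt * sy); first by small; case: (lt); lia.
op (~~ lt * hiy); first by small; case: (lt) => /=; lia.
op (if lt then sy else hiy); first by small; case: (lt) => /=; lia.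
exact: (@runs_nil _ _ [:: _; _; _; _; _; _; _; _; _; _; _; _; _]).
Qed.

Lemma triple_while_true w (M : word w -> word w) e1 e2 e3 r p t1 t2 :
  r < size e1 -> nth 0 e1 r != 0 ->
  triple M e1 p t1 e2 -> triple M e2 (PWhile r p) t2 e3 ->
  triple M e1 (PWhile r p) (t1 + t2).+1 e3.
Proof.
move=> hr h0 hp hq s1 hs1.
have [s2 [ex1 /hq [s3 [ex2 hs]]]] := hp s1 hs1.
by exists s3; split=> //; apply: ExecWhileTrue ex1 ex2; rewrite (proj2 hs1).
Qed.

Lemma triple_while_false w (M : word w -> word w) e r p :
  r < size e -> nth 0 e r = 0 -> triple M e (PWhile r p) 1 e.
Proof.
by move=> hr h0 s hs; exists s; split=> //; apply: ExecWhileFalse; rewrite (proj2 hs).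
Qed.

(** The first [n] words are the base [2 ^ w] digits of a single number [V]. *)
Definition holds (w : nat) (M : word w -> word w) (V n : nat) : Prop :=
  forall q, q < n -> M (to_word w q) = V %/ 2 ^ (q * w) %% 2 ^ w :> nat.

Definition read_block : seq instr :=
  [:: IOp OpDiv 14 3 2; IOp OpMod 15 3 2; ILoad 13 14; IOp OpAdd 14 14 10;
      ILoad 16 14; IOp OpShr 13 13 15; IOp OpSub 15 2 15; IOp OpShl 16 16 15;
      IOp OpAdd 13 13 16; IOp OpMod 14 13 12].

Lemma runs_read w (M : word w -> word w) V n x y A lox loy hix hiy r8 r9 r11 :
  holds M V n -> n <= 2 ^ w -> (A %/ w).+1 < n -> A < 2 ^ w -> 0 < w ->
  let X := V %/ 2 ^ A %% 2 ^ w in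
  runs M [:: x; y; w; A; lox; loy; hix; hiy; r8; r9; 1; r11; 2]
    read_block
    [:: x; y; w; A; lox; loy; hix; hiy; r8; r9; 1; r11; 2; X; X %% 2].
Proof.
move=> hM nw An Aw w0 X; rewrite /read_block.
have ww : w < 2 ^ w by rewrite ltn_expl.
have rw : A %% w < w by rewrite ltn_mod.
have Xw : X < 2 ^ w by rewrite ltn_mod expn_gt0.
apply: (@runs_temporaries _ _ 4) => -[|u0 [|u1 [|u2 [|u3 [|]]]]] // _; cbn [cat].
op (A %/ w); first by small; lia.
op (A %% w); first by small; lia.
apply: (@runs_load _ _ _ _ _ _ (V %/ 2 ^ (A %/ w * w) %% 2 ^ w)) => //; cbn [nth set_nth].
  by apply: hM; lia.
op (A %/ w).+1; first by rewrite addn1; small; lia.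
apply: (@runs_load _ _ _ _ _ _ (V %/ 2 ^ ((A %/ w).+1 * w) %% 2 ^ w)) => //; cbn [nth set_nth].
  exact: hM.
op (V %/ 2 ^ (A %/ w * w) %% 2 ^ w %/ 2 ^ (A %% w)).
  by small; apply: leq_ltn_trans (leq_div _ _) _; rewrite ltn_mod expn_gt0.
op (w - A %% w).
  have -> : w + 2 ^ w - A %% w = w - A %% w + 2 ^ w by lia.
  by rewrite modnDr; small; lia.
op ((V %/ 2 ^ ((A %/ w).+1 * w) %% 2 ^ w * 2 ^ (w - A %% w)) %% 2 ^ w).
  by [].
op X; first by rewrite read_unaligned // modn_mod.
op (X %% 2); first by small; apply: leq_ltn_trans (leq_mod _ _) _.
exact: (@runs_nil _ _ [:: _; _; _; _; _; _; _; _; _; _; _; _; _; _; _]).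
Qed.

(** * One search step and the search loop *)

Definition node_prog : prog :=
  PSeq (block fields_block)
    (PSeq (block base_block) (PSeq (block compare_block) (block update_block))).

Definition step_prog : prog :=
  PSeq (block read_block) (PIf 14 node_prog (block [:: IConst 8 0])).

(** A common cell of height [h] fixes the coordinates above bit [h]; this is why a record may omit
    them. *)
Lemma split_height_coord m a b h : a < 4 ^ m -> b < 4 ^ m -> split_height m a b <= h ->
  xcoord m a %/ 2 ^ h = xcoord m b %/ 2 ^ h /\ ycoord m a %/ 2 ^ h = ycoord m b %/ 2 ^ h.
Proof.
move=> ha hb; rewrite split_height_le // => /eqP E.
have [hm|/ltnW mh] := leqP h m; first by rewrite !xcoord_div // !ycoord_div // E.
have lt2 u : u < 2 ^ m -> u < 2 ^ h by move=> /leq_trans; apply; rewrite leq_exp2l.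
by rewrite !divn_small ?lt2 ?xcoord_lt ?ycoord_lt.
Qed.

Definition search_env (m w z A lo hi r8 r9 r11 : nat) : seq nat :=
  [:: xcoord m z; ycoord m z; w; A; xcoord m lo; ycoord m lo; xcoord m hi; ycoord m hi;
      r8; r9; 1; r11; 2].

(* [lo] and [hi] are the nearest keys met so far, or the extreme codes. *)
Definition located (m V L A lo hi : nat) (t : bst) : Prop :=
  [/\ lo <= hi, hi < 4 ^ m, between lo hi (keys t),
      V %/ 2 ^ A %% 2 ^ tree_bits m lo hi t = tree_code m lo hi t
    & A + tree_bits m lo hi t <= L].

Definition step_time : nat := 80.

(** As [h <= m], the record has at most [7 * m + 45 <= w] bits, so one window contains all of it. *)
Lemma step_branch m w (M : word w -> word w) V n L A z lo hi l s r r11 :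
  7 * m + 45 <= w -> n <= 2 ^ w -> L %/ w + 1 < n -> L < 2 ^ w ->
  holds M V n -> z < 4 ^ m -> located m V L A lo hi (Branch l s r) ->
  let lt := z < s in
  let lo' := if lt then lo else s in
  let hi' := if lt then s else hi in
  exists A',
    triple M (search_env m w z A lo hi 1 0 r11) step_prog step_time
      (search_env m w z A' lo' hi' (z != s) (z == s) r11)
    /\ located m V L A' lo' hi' (if lt then l else r).
Proof.
move=> mw nw Ln Lw hM hz [lohi him bt] /=.
have [/andP [ls sh] bl br _ _] := between_cat bt.
have sm : s < 4 ^ m := leq_ltn_trans sh him.
have lom : lo < 4 ^ m := leq_ltn_trans ls sm.
set h := minn _ _; set d := split_height m s hi < split_height m lo s.
set bl' := tree_bits m lo s l; set br' := tree_bits m s hi r.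
have near_height : (if d then split_height m s hi else split_height m lo s) <= h.
  by rewrite /h /d; case: ltnP.
have hm : h <= m by apply: leq_trans (geq_minl _ _) (split_height_bound _ _ _).
clearbody h d.
set G := 2 ^ (h + 6).
have G3 : 2 ^ (3 * (h + 6)) = G ^ 3 by rewrite mulnC expnM.
have G3w : G ^ 3 < 2 ^ w by rewrite -G3 ltn_exp2l //; lia.
have G1 : 1 < G by rewrite -{1}(expn0 2) ltn_exp2l // addnS.
have w0 : 0 < w by lia.
have c2w u : u < 2 ^ m -> u < 2 ^ w by move=> /leq_trans; apply; rewrite leq_exp2l //; lia.
have rbw : record_bits h <= w by rewrite /record_bits; lia.
(* Naming the subtrees by their order in memory merges the two cases of [tree_code]. *)
set near := if d then br' else bl'.
set far := if d then bl' else br'.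
set cnear := if d then tree_code m s hi r else tree_code m lo s l.
set cfar := if d then tree_code m lo s l else tree_code m s hi r.
have -> : bl' + br' = near + far by rewrite /near /far; case: (d); rewrite // addnC.
have -> : (if d then
   record m h true s br' + 2 ^ record_bits h * (tree_code m s hi r + 2 ^ br' * tree_code m lo s l)
  else record m h false s bl'
    + 2 ^ record_bits h * (tree_code m lo s l + 2 ^ bl' * tree_code m s hi r))
  = record m h d s near + 2 ^ record_bits h * (cnear + 2 ^ near * cfar).
  by rewrite /near /cnear /cfar; case: (d).
rewrite (expnD 2 (record_bits h)) (expnD 2 near) => code AL.
have [code_rec code_rest] := modn_low (record_lt m h d s near) code.
have cnear_lt : cnear < 2 ^ near by rewrite /cnear /near; case: (d); rewrite tree_code_lt.
have [code_near code_far] := modn_low cnear_lt code_rest.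
have near_lt : near < 2 ^ (3 * (h + 6)).
  by rewrite /near; case: (d) near_height => dE; apply: tree_bits_lt.
set X := V %/ 2 ^ A %% 2 ^ w.
have Xw : X < 2 ^ w by rewrite ltn_mod expn_gt0.
have XE : X = record m h d s near + 2 ^ record_bits h * (X %/ 2 ^ record_bits h).
  rewrite {1}(divn_eq X (2 ^ record_bits h)) addnC mulnC; congr (_ + _).
  by rewrite /X modn_dvdm // dvdn_exp2l.
set Y := X %/ _ in XE.
have XF : X = 1 + 2 * d + 4 * (G * (1 + 2 * (xcoord m s %% G + G * (ycoord m s %% G + G *
    (record_bits h + G * (near + G ^ 3 * Y)))))).
  have near_mod : near %% G ^ 3 = near by rewrite modn_small // -G3.
  rewrite {1}XE record_bitsE /record -/G near_mod.
  have -> : G ^ 7 = G * (G * (G * (G * G ^ 3))) by rewrite -!expnS.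
  by clear; move: (G ^ 3) (G) => G' G0; lia.
set lt := z < s; set lo' := if lt then lo else s; set hi' := if lt then s else hi.
exists (A + record_bits h + (lt == d) * near); split.
  (* A block costs its length plus one for the closing [PSkip]; the branch adds one. *)
  have -> : step_time = 11 + (18 + (14 + (18 + 18))).+1 by [].
  rewrite /step_prog /node_prog /search_env.
  have AL' : A <= L by apply: leq_trans (leq_addr _ _) AL.
  have Aw : A < 2 ^ w := leq_ltn_trans AL' Lw.
  have Anw : (A %/ w).+1 < n.
    by apply: leq_ltn_trans Ln; rewrite -addn1 leq_add2r leq_div2r.
  apply: triple_seq (runs_read hM nw Anw Aw w0) _; rewrite -/X.
  have X2 : X %% 2 = 1 by rewrite XF; move: (G * _); clear; lia.
  apply: triple_if_true => //; first by rewrite /= X2.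
  apply: triple_seq (runs_fields XF Xw _ _ _ _ G3w G1) _;
    rewrite ?ltn_mod ?(ltnW G1) ?record_bits_lt -?G3 //.
  have [bx by'] : (if d then xcoord m hi else xcoord m lo) %/ G * G + xcoord m s %% G
     = xcoord m s /\ (if d then ycoord m hi else ycoord m lo) %/ G * G + ycoord m s %% G
     = ycoord m s.
    (* The record keeps [h + 6] low bits although [h] suffice, so agreement above bit [h] is more
       than enough. *)
    have hh : h <= h + 6 by rewrite leq_addr.
    case: (d) near_height => /leq_trans/(_ hh) dE.
      have [ex ey] := split_height_coord sm him dE.
      by rewrite -/G in ex ey; rewrite -ex -ey -!divn_eq.
    have [ex ey] := split_height_coord lom sm dE.
    by rewrite -/G in ex ey; rewrite ex ey -!divn_eq.
  apply: triple_seq (runs_base w0 _ _ _ _ bx by' _ _) _;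
    rewrite ?c2w ?xcoord_lt ?ycoord_lt //.
  apply: triple_seq (runs_compare w0 _ _ _ _) _;
    rewrite ?c2w ?xcoord_lt ?ycoord_lt //.
  rewrite coord_eq // zless_coord // -/lt.
  rewrite /lo' /hi' !(fun_if (xcoord m)) !(fun_if (ycoord m)).
  have fits : A + record_bits h + near < 2 ^ w.
    by apply: leq_ltn_trans Lw; apply: leq_trans AL; rewrite !addnA leq_addr.
  by apply: runs_update => //; rewrite c2w ?xcoord_lt ?ycoord_lt.
have near_at : V %/ 2 ^ (A + record_bits h) %% 2 ^ near = cnear.
  by rewrite (expnD 2 A) divnMA.
have far_at : V %/ 2 ^ (A + record_bits h + near) %% 2 ^ far = cfar.
  by rewrite (expnD 2 (A + _)) (expnD 2 A) !divnMA.
rewrite /lo' /hi' /lt; case: ifP => zs; split=> //;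
  move: near_at far_at AL; rewrite /near /far /cnear /cfar /bl' /br';
  case: (d) => /= na fa al; rewrite ?mul0n ?mul1n ?addn0 //; clear -al; lia.
Qed.

Lemma step_empty m w (M : word w -> word w) V n L A z lo hi r11 :
  0 < w -> n <= 2 ^ w -> L %/ w + 1 < n -> L < 2 ^ w ->
  holds M V n -> located m V L A lo hi Empty ->
  triple M (search_env m w z A lo hi 1 0 r11) step_prog 14
      (search_env m w z A lo hi 0 0 r11).
Proof.
move=> w0 nw Ln Lw hM [_ _ _ /= code AL].
have Aw : A < 2 ^ w by lia.
have Anw : (A %/ w).+1 < n.
  by apply: leq_ltn_trans Ln; rewrite -addn1 leq_add2r leq_div2r //; lia.
have -> : 14 = 11 + 2.+1 by [].
rewrite /step_prog /search_env.
apply: triple_seq (runs_read hM nw Anw Aw w0) _.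
apply: triple_if_false; [by [] | | ].
  by rewrite /= modn_dvdm // -{1}(expn1 2) dvdn_exp2l.
apply: (@runs_const _ _ _ _ 8 0 [::]); [by [] | by rewrite expn_gt0 | cbn [set_nth]].
exact: (@runs_nil _ _ [:: _; _; _; _; _; _; _; _; _; _; _; _; _]).
Qed.

(** Each unit of [steps], the visit to an empty tree included, is one round with its test; the final
    1 is the test that leaves the loop. *)
Lemma search_loop m w (M : word w -> word w) V n L z t A lo hi r11 :
  7 * m + 45 <= w -> n <= 2 ^ w -> L %/ w + 1 < n -> L < 2 ^ w ->
  holds M V n -> z < 4 ^ m -> located m V L A lo hi t ->
  exists T A' lo' hi', T <= step_time.+1 * steps z t + 1 /\
    triple M (search_env m w z A lo hi 1 0 r11) (PWhile 8 step_prog) T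
      (search_env m w z A' lo' hi' 0 (z \in keys t) r11).
Proof.
move=> mw nw Ln Lw hM hz; have w0 : 0 < w by lia.
elim: t A lo hi => [|l IHl s r IHr] A lo hi loc.
  exists (14 + 1).+1, A, lo, hi; split; first by rewrite /= muln1.
  apply: triple_while_true => //; first exact: step_empty hM loc.
  exact: triple_while_false.
have [_ _ bt _ _] := loc.
have [A' [tr loc']] := step_branch r11 mw nw Ln Lw hM hz loc.
rewrite [keys _]/= (between_mem z bt) /=.
have [zs|zs] := eqVneq z s.
  subst z; rewrite eqxx in tr.
  exists (step_time + 1).+1, A', (if s < s then lo else s), (if s < s then s else hi).
  split; first by rewrite muln1; lia.
  apply: triple_while_true => //; first exact: tr.
  exact: triple_while_false.
rewrite zs (negbTE zs) in tr.
case: ifP tr loc' => zlt tr loc'.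
  have [T [A'' [lo' [hi' [hT tr']]]]] := IHl _ _ _ loc'.
  exists (step_time + T).+1, A'', lo', hi'; split; first by rewrite mulnS; lia.
  by apply: triple_while_true tr tr'.
have [T [A'' [lo' [hi' [hT tr']]]]] := IHr _ _ _ loc'.
exists (step_time + T).+1, A'', lo', hi'; split; first by rewrite mulnS; lia.
by apply: triple_while_true tr tr'.
Qed.

(** * From the stored bit string to a number *)

Lemma testbitE a n : Nat.testbit a n = odd (a %/ 2 ^ n).
Proof.
have oddE b : Nat.odd b = odd b.
  have [n' IH] := ubnP b; elim: n' b IH => // n' IH [|[|b]] // hb.
  by rewrite [RHS]/= negbK -IH //; lia.
have div2E b : Nat.div2 b = b %/ 2.
  have [n' IH] := ubnP b; elim: n' b IH => // n' IH [|[|b]] // hb.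
  by rewrite [LHS]/= IH; lia.
elim: n a => [|n IH] a; first by rewrite expn0 divn1 [LHS]/= oddE.
by rewrite [LHS]/= IH div2E expnS divnMA.
Qed.

Lemma eq_from_bits w u v : u < 2 ^ w -> v < 2 ^ w ->
  (forall i, i < w -> odd (u %/ 2 ^ i) = odd (v %/ 2 ^ i)) -> u = v.
Proof.
elim: w u v => [|w IH] u v.
  by rewrite expn0 !ltnS !leqn0 => /eqP -> /eqP ->.
rewrite expnS => hu hv H.
have E : u %/ 2 = v %/ 2.
  apply: IH; try lia.
  by move=> i hi; have := H i.+1; rewrite !expnS !divnMA; exact.
by have := H 0 isT; rewrite !expn0 !divn1; lia.
Qed.

Lemma odd_mod_div a w i : i < w -> odd (a %% 2 ^ w %/ 2 ^ i) = odd (a %/ 2 ^ i).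
Proof.
move=> iw.
have -> : 2 ^ w = 2 ^ i * (2 * 2 ^ (w - i.+1)).
  by rewrite -expnS -expnD; congr (_ ^ _); lia.
rewrite modn_mul_split addnC mulnC divnMDl ?expn_gt0 //.
rewrite (divn_small (ltn_pmod _ _)) ?expn_gt0 // addn0 modn_mul_split oddD oddM /= addbF.
by move: (a %/ _); lia.
Qed.

Lemma stores_holds w (M : word w -> word w) V n : 0 < w ->
  stores M (mkseq (Nat.testbit V) (n * w)) -> holds M V n.
Proof.
move=> w0 st q qn; apply: (@eq_from_bits w); rewrite ?ltn_mod ?expn_gt0 ?ltn_ord //.
move=> i iw; have lt : q * w + i < n * w.
  by apply: leq_trans (_ : q.+1 * w <= _); [rewrite mulSn; lia | rewrite leq_mul2r qn orbT].
have := st (q * w + i); rewrite size_mkseq => /(_ lt).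
rewrite nth_mkseq // divnMDl // divn_small // addn0 modnMDl modn_small //.
by rewrite !testbitE => ->; rewrite odd_mod_div // expnD divnMA.
Qed.

(** * The whole query program *)

Lemma xcoord0 m : xcoord m 0 = 0. Proof. by elim: m => //= m ->. Qed.

Lemma ycoord0 m : ycoord m 0 = 0. Proof. by elim: m => //= m ->. Qed.

Lemma coord_max m : xcoord m (4 ^ m).-1 = (2 ^ m).-1 /\ ycoord m (4 ^ m).-1 = (2 ^ m).-1.
Proof.
elim: m => [//|m [IHx IHy]].
have p4 : 0 < 4 ^ m by rewrite expn_gt0.
have p2 : 0 < 2 ^ m by rewrite expn_gt0.
have E : (4 ^ m.+1).-1 %/ 4 = (4 ^ m).-1 by rewrite expnS; lia.
have o1 : odd (4 ^ m.+1).-1 by rewrite expnS; lia.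
have o2 : odd ((4 ^ m.+1).-1 %/ 2) by rewrite expnS; lia.
by rewrite /= E IHx IHy o1 o2 expnS; lia.
Qed.

(** The program is the same for all [m] and [w], so it takes [w] and the coordinates of the greatest
    code from the two header words; the tree starts at bit [2 * w]. Division by 1 copies a
    register. *)
Definition init_block : seq instr :=
  [:: IOp OpDiv 2 11 12; ILoad 6 10; IOp OpDiv 7 6 10; IOp OpAdd 3 2 2; IConst 8 1].

(** Register 8 is still 0 at the first load, which therefore reads the first word; its parity tells
    whether the set is empty. *)
Definition main_prog : prog :=
  PSeq (block [:: ILoad 11 8; IConst 10 1; IConst 12 2; IOp OpMod 13 11 12])
    (PIf 13
      (PSeq (block init_block)
         (PSeq (PWhile 8 step_prog) (block [:: IOp OpMul 0 9 10])))
      (block [:: IConst 0 0])).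

Definition query_env (x y : nat) : seq nat := [:: x; y; 0; 0; 0; 0; 0; 0; 0; 0; 0; 0; 0; 0].

(* The first word is odd; a 0 bit alone stands for the empty set. *)
Definition header (w m code : nat) : nat :=
  (1 + 2 * w) + 2 ^ w * ((2 ^ m).-1 + 2 ^ w * code).

Lemma double_lt_exp k : 4 <= k -> 1 + 2 * k < 2 ^ k.
Proof.
move=> /subnK <-; elim: (k - 4) => [//|j]; rewrite addSn expnS; move: (2 ^ _) => p; lia.
Qed.

Lemma main_nonempty m w (M : word w -> word w) n z t :
  let hi := (4 ^ m).-1 in
  let L := 2 * w + tree_bits m 0 hi t in
  7 * m + 45 <= w -> n <= 2 ^ w -> L %/ w + 1 < n -> L < 2 ^ w ->
  holds M (header w m (tree_code m 0 hi t)) n -> z < 4 ^ m -> between 0 hi (keys t) ->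
  exists2 T, T <= step_time.+1 * steps z t + 15 &
    triple M (query_env (xcoord m z) (ycoord m z)) main_prog T [:: (z \in keys t) : nat].
Proof.
move=> hi L mw nw Ln Lw hM hz bt.
set V := header _ _ _ in hM.
have w0 : 0 < w by lia.
have W0 : 0 < 2 ^ w by rewrite expn_gt0.
have wmw : (2 ^ m).-1 < 2 ^ w.
  have le : 2 ^ m <= 2 ^ w by rewrite leq_exp2l //; lia.
  by apply: leq_trans le; rewrite prednK ?expn_gt0.
have n1 : 1 < n by apply: leq_ltn_trans Ln; rewrite leq_addl.
have h0w : 1 + 2 * w < 2 ^ w.
  by apply: double_lt_exp; lia.
have V0 : V %% 2 ^ w = 1 + 2 * w.
  by rewrite /V /header addnC mulnC modnMDl modn_small.
have V1 : V %/ 2 ^ w = (2 ^ m).-1 + 2 ^ w * tree_code m 0 hi t.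
  by rewrite /V /header addnC mulnC divnMDl // divn_small // addn0.
have V2 : V %/ 2 ^ (2 * w) = tree_code m 0 hi t.
  by rewrite mul2n -addnn expnD divnMA V1 addnC mulnC divnMDl // divn_small // addn0.
have loc : located m V L (2 * w) 0 hi t.
  split=> //.
    by rewrite /hi ltn_predL expn_gt0.
  by rewrite V2 modn_small ?tree_code_lt.
have [T [A' [lo' [hi' [hT loop]]]]] := search_loop (1 + 2 * w) mw nw Ln Lw hM hz loc.
have [Hx Hy] := coord_max m.
exists (5 + (6 + (T + 2)).+1); first by lia.
have b1 (b : bool) : b < 2 ^ w.
  by apply: leq_ltn_trans (leq_b1 b) _; rewrite -{1}(expn0 2) ltn_exp2l.
apply: (@triple_seq _ _ _ [:: xcoord m z; ycoord m z; 0; 0; 0; 0; 0; 0; 0; 0; 1; 1 + 2 * w; 2; 1]).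
  apply: (@runs_load _ _ _ _ _ _ (1 + 2 * w)); [by [] | | cbn [query_env set_nth]].
    by rewrite [nth _ _ _]/= hM ?mul0n ?expn0 ?divn1 //; lia.
  apply: runs_const; [by [] | by apply: (b1 true) | cbn [set_nth]].
  apply: runs_const; [by [] | by lia | cbn [set_nth]].
  op 1; first by small; lia.
  exact: (@runs_nil _ _ [:: _; _; _; _; _; _; _; _; _; _; _; _; _; _]).
apply: triple_if_true => //.
apply: (@triple_seq _ _ _ (search_env m w z (2 * w) 0 hi 1 0 (1 + 2 * w))).
  rewrite /search_env xcoord0 ycoord0 Hx Hy.
  op w; first by small; lia.
  apply: (@runs_load _ _ _ _ _ _ (2 ^ m).-1); [by [] | | cbn [set_nth]].
    rewrite [nth _ _ _]/= hM // mul1n V1 addnC mulnC modnMDl modn_small //.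
  op (2 ^ m).-1; first by rewrite divn1; small.
  op (2 * w); first by small; lia.
  apply: runs_const; [by [] | by apply: (b1 true) | cbn [set_nth]].
  exact: (@runs_nil _ _ [:: _; _; _; _; _; _; _; _; _; _; _; _; _]).
apply: triple_seq loop _; rewrite /search_env.
op ((z \in keys t) : nat); first by rewrite muln1; small.
exact: (@runs_nil _ _ [:: _]).
Qed.

Lemma main_empty w (M : word w -> word w) x y : 1 < w ->
  M (to_word w 0) %% 2 = 0 -> triple M (query_env x y) main_prog 8 [:: 0].
Proof.
move=> w1 h0.
have lt2 : 2 < 2 ^ w by rewrite -{1}(expn1 2) ltn_exp2l.
set h := nat_of_ord (M (to_word w 0)) in h0.
have -> : 8 = 5 + 2.+1 by [].
apply: (@triple_seq _ _ _ [:: x; y; 0; 0; 0; 0; 0; 0; 0; 0; 1; h; 2; 0]).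
  apply: (@runs_load _ _ _ _ _ _ h); [by [] | by [] | cbn [query_env set_nth]].
  apply: runs_const; [by [] | by lia | cbn [set_nth]].
  apply: runs_const; [by [] | by [] | cbn [set_nth]].
  op 0; first by rewrite h0 mod0n.
  exact: (@runs_nil _ _ [:: _; _; _; _; _; _; _; _; _; _; _; _; _; _]).
apply: triple_if_false => //.
apply: (@runs_const _ _ _ _ 0 0 [::]); [by [] | by lia | cbn [set_nth]].
exact: (@runs_nil _ _ [:: _]).
Qed.

Lemma query_state_env w m (M : word w -> word w) (c : cell m) : m <= w ->
  in_state M (query_env c.1 c.2) (query_state M c).
Proof.
move=> mw; have W0 : 0 < 2 ^ w by rewrite expn_gt0.
have le : 2 ^ m <= 2 ^ w by rewrite leq_exp2l.
split=> // -[|[|r]] /= hr.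
- by rewrite modn_small // (leq_trans (ltn_ord _) le).
- by rewrite modn_small // (leq_trans (ltn_ord _) le).
- rewrite mod0n; by do 12![case: r hr => // r hr].
Qed.

(** * Codes of a point set and the size of its quadtree *)

(** Follows the recursion of [quadtree], so that both are compared in one induction; [mem_codes]
    relates it to the coordinates. *)
Fixpoint codes (m : nat) : {set cell m} -> seq nat :=
  match m return {set cell m} -> seq nat with
  | 0 => fun P => if P == finset.set0 then [::] else [:: 0]
  | k.+1 => fun P =>
      map (addn (0 * 4 ^ k)) (codes (quadrant P false false)) ++
      map (addn (1 * 4 ^ k)) (codes (quadrant P false true)) ++
      map (addn (2 * 4 ^ k)) (codes (quadrant P true false)) ++
      map (addn (3 * 4 ^ k)) (codes (quadrant P true true))
  end.

Definition cell_of (m z : nat) : cell m :=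
  (Ordinal (xcoord_lt m z), Ordinal (ycoord_lt m z)).

Lemma zcode_coord m z : z < 4 ^ m -> zcode m (xcoord m z) (ycoord m z) = z.
Proof.
move=> hz; apply/eqP; rewrite -(@coord_eq m) ?zcode_lt //.
by rewrite xcoord_zcode ?xcoord_lt // ycoord_zcode ?ycoord_lt // !eqxx.
Qed.

Lemma cell_of_top m (a b : bool) z : z < 4 ^ m ->
  cell_of m.+1 ((2 * a + b) * 4 ^ m + z)
  = (half_coord a (cell_of m z).1, half_coord b (cell_of m z).2).
Proof.
move=> hz; rewrite -{1}(zcode_coord hz) -zcode_top ?xcoord_lt ?ycoord_lt //.
have lt (c : bool) u : u < 2 ^ m -> c * 2 ^ m + u < 2 ^ m.+1.
  by rewrite expnS; case: c; lia.
congr (_, _); apply: val_inj.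
  exact: (xcoord_zcode _ (lt _ _ (xcoord_lt _ _))).
exact: (ycoord_zcode _ (lt _ _ (ycoord_lt _ _))).
Qed.

Lemma codes_lt m (P : {set cell m}) z : z \in codes P -> z < 4 ^ m.
Proof.
elim: m P z => [|m IH] P z /=; first by case: ifP => _; rewrite ?inE // => /eqP ->.
by rewrite !mem_cat => /or4P [] /mapP [y /IH hy ->]; rewrite block_lt.
Qed.

Lemma sorted_cat_ltn B l1 l2 : sorted ltn l1 -> sorted ltn l2 ->
  (forall z, z \in l1 -> z < B) -> (forall z, z \in l2 -> B <= z) ->
  sorted ltn (l1 ++ l2).
Proof.
rewrite !(sorted_pairwise ltn_trans) pairwise_cat => -> -> h1 h2; rewrite !andbT.
by apply/allrelP => x y /h1 hx /h2; apply: leq_trans.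
Qed.

Lemma sorted_codes m (P : {set cell m}) : sorted ltn (codes P).
Proof.
elim: m P => [|m IH] P /=; first by case: ifP.
have so c (Q : {set cell m}) : sorted ltn (map (addn (c * 4 ^ m)) (codes Q)).
  by rewrite sorted_map; apply: sub_sorted (IH Q) => x y; rewrite /= ltn_add2l.
have low c (Q : {set cell m}) z : z \in map (addn (c * 4 ^ m)) (codes Q) -> c * 4 ^ m <= z.
  by case/mapP => y _ ->; rewrite leq_addr.
have up c (Q : {set cell m}) z : z \in map (addn (c * 4 ^ m)) (codes Q) -> z < c.+1 * 4 ^ m.
  by case/mapP => y /codes_lt hy ->; rewrite mulSn addnC ltn_add2r.
apply: (@sorted_cat_ltn (1 * 4 ^ m)) => //; last 2 first.
- exact: up.
- move=> z; rewrite !mem_cat => /or3P [] /low // le; apply: leq_trans le; rewrite leq_mul2r //.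
  by rewrite orbT.
  by rewrite orbT.
apply: (@sorted_cat_ltn (2 * 4 ^ m)) => //; last 2 first.
- exact: up.
- move=> z; rewrite !mem_cat => /orP [] /low // le; apply: leq_trans le; rewrite leq_mul2r //.
  by rewrite orbT.
by apply: (@sorted_cat_ltn (3 * 4 ^ m)) => //; [exact: up | exact: low].
Qed.

Lemma mem_codes m (P : {set cell m}) z : z < 4 ^ m ->
  (z \in codes P) = (cell_of m z \in P).
Proof.
elim: m P z => [|m IH] P z.
  rewrite expn0 ltnS leqn0 => /eqP -> /=.
  case: eqVneq => [->|/set0Pn [c cP]]; first by rewrite !inE.
  rewrite inE eqxx; apply/esym; suff -> : cell_of 0 0 = c by [].
  by case: c {cP} => -[[|i] hi] [[|j] hj] //; congr (_, _); apply: val_inj.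
move=> hz; have p4 : 0 < 4 ^ m by rewrite expn_gt0.
set q := z %/ 4 ^ m; set y := z %% 4 ^ m.
have hy : y < 4 ^ m by rewrite ltn_mod.
have zE : z = q * 4 ^ m + y := divn_eq _ _.
have q4 : q < 4 by rewrite ltn_divLR // -expnS.
have blk c (Q : {set cell m}) :
    (z \in map (addn (c * 4 ^ m)) (codes Q)) = (q == c) && (cell_of m y \in Q).
  rewrite -IH //; apply/mapP/andP => [[y' y'Q e]|[/eqP <- yQ]]; last by exists y.
  have y'lt := codes_lt y'Q.
  have -> : q = c by rewrite /q e divnMDl // divn_small // addn0.
  suff -> : y = y' by [].
  by rewrite /y e modnMDl modn_small.
have top (a b : bool) : q = 2 * a + b ->
   (cell_of m.+1 z \in P) = (cell_of m y \in quadrant P a b).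
  by move=> qE; rewrite zE qE cell_of_top // inE.
rewrite [codes _]/= !mem_cat !blk.
have [q0|q1|q2|q3] : [\/ q = 0, q = 1, q = 2 | q = 3].
  by move: (q) q4 => -[|[|[|[|]]]] // _; [constructor 1|constructor 2|constructor 3|constructor 4].
- by rewrite q0 (top false false) //= !orbF.
- by rewrite q1 (top false true) //= !orbF.
- by rewrite q2 (top true false) //= !orbF.
- by rewrite q3 (top true true).
Qed.

Lemma codes0 m (P : {set cell m}) : P = finset.set0 -> codes P = [::].
Proof.
move=> ->; case E: (codes _) => [//|z l].
have : z \in codes (finset.set0 : {set cell m}) by rewrite E mem_head.
by move=> H; move: (H); rewrite mem_codes ?(codes_lt H) // inE.
Qed.

(** For sorted codes and [h = m + 1] this counts the nodes of their trie: [m + 1] on the path to the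
    first key, then for each later key as many new nodes as its split height from the previous
    one. *)
Definition weight (h m : nat) (l : seq nat) : nat :=
  if l is a :: l' then chain m a l' + h else 0.

(** The link between the lists has split height [h], which is the offset of the second list. *)
Lemma weight_cat h m l1 l2 :
  (forall a b, a \in l1 -> b \in l2 -> split_height m a b = h) ->
  weight h m (l1 ++ l2) = weight h m l1 + weight h m l2.
Proof.
case: l1 => [//|a l1] H; case: l2 H => [|b l2] H; first by rewrite cats0 addn0.
rewrite /= chain_cat.
have -> : chain m a (rcons l1 b) = chain m a l1 + h.
  elim: l1 a H => [|c l1 IH] a H /=; first by rewrite H ?mem_head // addnC.
  by rewrite IH ?addnA // => x y hx; apply: H; rewrite in_cons hx orbT.
lia.
Qed.

Lemma weight_shift h m c l : c < 4 -> (forall z, z \in l -> z < 4 ^ m) ->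
  weight h m.+1 (map (addn (c * 4 ^ m)) l) = weight h m l.
Proof.
move=> c4; case: l => [//|a l] H /=; congr (_ + _).
elim: l a H => [//|b l IH] a H.
have chain_cons k x y s : chain k x (y :: s) = split_height k x y + chain k y s by [].
rewrite map_cons !chain_cons.
have ha : a < 4 ^ m by apply: H; rewrite mem_head.
have hb : b < 4 ^ m by apply: H; rewrite !in_cons eqxx orbT.
have {}IH := IH b (fun z hz => H z ltac:(by rewrite in_cons hz orbT)).
by rewrite split_height_shift // [X in _ + X]IH.
Qed.

(** Different quadrants split at height [m + 1], so the weights of the quadrants add up. The depth
    [d] is general because the hypothesis is passed on to subtrees. *)
Lemma weight_codes m (P : {set cell m}) d :
  (forall d', (d', true) \in leaves_from d (quadtree P) -> d' = d + m) ->
  weight m.+1 m (codes P) <= num_nodes (quadtree P).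
Proof.
elim: m P d => [|m IH] P d H; first by rewrite /=; case: ifP.
rewrite [quadtree P]/= in H *.
have [P0|Pn0] := eqVneq P finset.set0; first by rewrite codes0.
rewrite (negbTE Pn0) in H.
(* A full grid above the bottom level would be a leaf storing 1 at a depth that [H] excludes. *)
have [PT|PnT] := eqVneq P (finset.setTfor (cell m.+1)).
  by move: H; rewrite PT eqxx => /(_ d); rewrite inE eqxx => /(_ isT); lia.
rewrite (negbTE PnT) in H.
have sub (Q : {set cell m}) :
    (forall d', (d', true) \in leaves_from d.+1 (quadtree Q) -> d' = d + m.+1) ->
    weight m.+1 m (codes Q) <= num_nodes (quadtree Q).
  by move=> HQ; apply: (IH Q d.+1) => d' /HQ ->; rewrite addSnnS.
have cross c c' (Q Q' : {set cell m}) a b : c < 4 -> c' < 4 -> c != c' ->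
    a \in map (addn (c * 4 ^ m)) (codes Q) -> b \in map (addn (c' * 4 ^ m)) (codes Q') ->
    split_height m.+1 a b = m.+1.
  move=> c4 c4' ne /mapP [a' /codes_lt ha ->] /mapP [b' /codes_lt hb ->].
  exact: split_height_cross.
rewrite [leaves_from _ _]/= in H.
rewrite [num_nodes _]/=.
(* The offset grows by one with the level; the root pays for it. *)
have W : weight m.+2 m.+1 (codes P) <= (weight m.+1 m.+1 (codes P)).+1.
  by rewrite /weight; case: (codes P) => [//|z l]; rewrite addnS.
apply: leq_trans W _; rewrite ltnS [codes P]/=.
rewrite weight_cat; last first.
  move=> a b ha; rewrite !mem_cat => /or3P [] hb; exact: cross ha hb.
rewrite weight_cat; last first.
  move=> a b ha; rewrite !mem_cat => /orP [] hb; exact: cross ha hb.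
rewrite weight_cat; last by move=> a b ha hb; exact: cross ha hb.
rewrite !weight_shift //; try exact: codes_lt.
have h1 := sub (quadrant P false false); have h2 := sub (quadrant P false true).
have h3 := sub (quadrant P true false); have h4 := sub (quadrant P true true).
rewrite !addnA; apply: leq_add; last by apply: h4 => d' hd; apply: H; rewrite !mem_cat hd !orbT.
apply: leq_add; last by apply: h3 => d' hd; apply: H; rewrite !mem_cat hd !orbT.
apply: leq_add; last by apply: h2 => d' hd; apply: H; rewrite !mem_cat hd !orbT.
by apply: h1 => d' hd; apply: H; rewrite !mem_cat hd.
Qed.

Lemma size_chain m a l : a < 4 ^ m -> path ltn a l -> (forall z, z \in l -> z < 4 ^ m) ->
  size l <= chain m a l.
Proof.
elim: l a => [//|b l IH] a ha /= /andP [ab pb] H.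
have hb : b < 4 ^ m by apply: H; rewrite mem_head.
have : 0 < split_height m a b.
  by rewrite ltnNge split_height_le // expn0 !divn1 neq_ltn ab.
have := IH b hb pb (fun z hz => H z ltac:(by rewrite in_cons hz orbT)); lia.
Qed.

Lemma between_codes m (P : {set cell m}) : between 0 (4 ^ m).-1 (codes P).
Proof.
rewrite /between sorted_codes; apply/allP => z /codes_lt; lia.
Qed.

(** Let [c] be the chain of the codes. There are at most [c + 1] keys, the height sum is at most
    [c + 2 * m], and the quadtree has at least [c + m + 1] nodes, which leaves room in the factor
    61. *)
Lemma tree_bits_codes m (P : {set cell m}) t : ones_at_bottom P -> keys t = codes P ->
  P != finset.set0 ->
  tree_bits m 0 (4 ^ m).-1 t <= 61 * num_nodes (quadtree P) /\ m < num_nodes (quadtree P).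
Proof.
move=> ob kt Pn0; have W := @weight_codes _ P 0 ob.
have p4 : (4 ^ m).-1 < 4 ^ m by rewrite ltn_predL expn_gt0.
have b : between 0 (4 ^ m).-1 (keys t) by rewrite kt between_codes.
have hs := height_sum_chain (leq0n _) p4 b.
have lt := @codes_lt m P; have so := sorted_codes P.
have ne : codes P <> [::].
  have /set0Pn [[x y] xyP] := Pn0 => e.
  have := @mem_codes m P (zcode m x y) (zcode_lt _ _ _).
  rewrite e in_nil; suff -> : cell_of m (zcode m x y) = (x, y) by rewrite xyP.
  by congr (_, _); apply: val_inj; rewrite /= ?xcoord_zcode ?ycoord_zcode.
rewrite tree_bits_sum; move: hs; rewrite kt.
case E: (codes P) ne W lt so => [//|a l] _ W lt so.
have la := size_chain (lt a (mem_head _ _)) so (fun z hz => lt z ltac:(by rewrite in_cons hz orbT)).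
have -> : chain m 0 (rcons (a :: l) (4 ^ m).-1)
  = split_height m 0 a + chain m a l + split_height m (last a l) (4 ^ m).-1.
  rewrite /= -addnA; congr (_ + _).
  by elim: (l) (a) => [|c l' IH] a' /=; rewrite ?addn0 // IH addnA.
have := split_height_bound m 0 a; have := split_height_bound m (last a l) (4 ^ m).-1.
move: W; rewrite /= ; lia.
Qed.

Lemma count_codes m (P : {set cell m}) (p : pred nat) (A : pred (cell m)) :
  (forall z, z < 4 ^ m -> cell_of m z \in P -> p z -> A (cell_of m z)) ->
  count p (codes P) <= #|A|.
Proof.
move=> H; rewrite -size_filter -(size_map (cell_of m)).
have lt z : z \in seq.filter p (codes P) -> z < 4 ^ m.
  by rewrite mem_filter => /andP [_ /codes_lt].
have inj : {in seq.filter p (codes P) &, injective (cell_of m)}.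
  move=> y z /lt hy /lt hz [/eqP ex /eqP ey].
  by apply/eqP; rewrite -(coord_eq hy hz) ex ey.
have un : uniq (map (cell_of m) (seq.filter p (codes P))).
  rewrite map_inj_in_uniq // filter_uniq //.
  by apply: sorted_uniq (sorted_codes P); [exact: ltn_trans | exact: ltnn].
rewrite -(card_uniqP un); apply: subset_leq_card; apply/fintype.subsetP => c /mapP [z zf ->].
have := zf; rewrite mem_filter => /andP [pz zc].
by rewrite unfold_in; apply: H => //; [exact: lt | rewrite -mem_codes // lt].
Qed.

(** * The query bound *)

Lemma ln2_gt0 (R : realType) : (0 < ln 2 :> R)%R.
Proof. by rewrite ln_gt0 // ltr1n. Qed.

Lemma le_lg (R : realType) (x y : R) : (0 < x)%R -> (x <= y)%R -> (lg x <= lg y)%R.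
Proof.
move=> x0 xy; rewrite /lg ler_pM2r ?invr_gt0 ?ln2_gt0 // ler_ln ?posrE //.
exact: lt_le_trans xy.
Qed.

Lemma lg_pow2 (R : realType) n : lg ((2 ^ n)%:R : R)%R = n%:R%R.
Proof.
by rewrite /lg natrX lnXn ?ltr0n // -(mulr_natl (ln _) n) mulfK // gt_eqF ?ln2_gt0.
Qed.

Lemma lg_ge0 (R : realType) (x : R) : (1 <= x)%R -> (0 <= lg x)%R.
Proof. by move=> x1; rewrite divr_ge0 ?ln_ge0 // ler1n. Qed.

(** A cell of side [2 ^ h.-1] has diameter below [2 ^ h]; for [h = 0] the cell is a single point. *)
Lemma dist_le (R : realType) m h (p c : cell m) (g : R) :
  (0 <= g)%R -> (h == 0) || ((2 ^ h)%:R <= g)%R ->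
  p.1 %/ 2 ^ h.-1 = c.1 %/ 2 ^ h.-1 -> p.2 %/ 2 ^ h.-1 = c.2 %/ 2 ^ h.-1 ->
  (dist R p c <= g)%R.
Proof.
move=> g0 hg e1 e2; rewrite /dist -(ger0_norm g0) -sqrtr_sqr ler_wsqrtr //.
case: h hg e1 e2 => [_|h /= hg].
  rewrite expn0 !divn1 => -> ->; rewrite !subrr expr0n /= addr0 sqr_ge0 //.
have near (a b : nat) : a %/ 2 ^ h = b %/ 2 ^ h ->
    ((a%:R - b%:R) ^+ 2 <= (2 ^ h)%:R ^+ 2 :> R)%R.
  move=> e; rewrite -ler_sqrt ?sqr_ge0 // !sqrtr_sqr.
  rewrite (ger0_norm (ler0n _ _)) ler_norml.
  have p2 : 0 < 2 ^ h by rewrite expn_gt0.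
  have := ltn_pmod a p2; have := ltn_pmod b p2.
  have := divn_eq a (2 ^ h); have := divn_eq b (2 ^ h); rewrite e.
  move: (b %/ 2 ^ h * 2 ^ h) => q; move: (a %% 2 ^ h) (b %% 2 ^ h) => u v.
  move: (2 ^ h) => P Eb Ea hv hu.
  have lu : (u%:R <= P%:R :> R)%R by rewrite ler_nat ltnW.
  have lv : (v%:R <= P%:R :> R)%R by rewrite ler_nat ltnW.
  have u0 : (0 <= u%:R :> R)%R by [].
  have v0 : (0 <= v%:R :> R)%R by [].
  by rewrite Ea Eb !natrD; apply/andP; split; lra.
move=> /near h1 /near h2.
have : ((2 ^ h)%:R * 2 <= g :> R)%R by rewrite -natrM -expnSr.
have : (0 <= (2 ^ h)%:R :> R)%R by [].
move: ((2 ^ h)%:R)%R h1 h2 => P; nra.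
Qed.

Lemma scale_ex (R : realType) m (g : R) : (1 <= g)%R -> (g <= (2 ^ m)%:R)%R ->
  exists h, [/\ h <= m, (h == 0) || ((2 ^ h)%:R <= g)%R & (g < (2 ^ h.+1)%:R)%R].
Proof.
move=> g1 gm.
have ex : exists h, (g < (2 ^ h.+1)%:R)%R.
  by exists m; apply: le_lt_trans gm _; rewrite ltr_nat ltn_exp2l.
case: (ex_minnP ex) => h hg hmin; exists h; split=> //.
  by apply: hmin; apply: le_lt_trans gm _; rewrite ltr_nat ltn_exp2l.
case: h hg hmin => [//|h] hg hmin /=.
by rewrite leNgt; apply/negP => /hmin; rewrite ltnn.
Qed.

(** For [g] between [2 ^ h] and [2 ^ h.+1], the cell of side [2 ^ h.-1] around the query lies within
    distance [g], so it holds at most [k_g] points; its depth exceeds [lg (u / g)] by at most 2. *)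
Lemma steps_le (R : realType) m (P : {set cell m}) (c : cell m) (g : R) :
  let l := codes P in
  (1 <= g)%R -> (g <= (2 ^ m)%:R)%R ->
  ((steps (zcode m c.1 c.2) (build (2 * m) (size l) 0 l))%:R <=
    24 + 8 * (lg ((2 ^ m)%:R / g) + lg (maxn 1 (num_within P c g))%:R) :> R)%R.
Proof.
move=> l g1 gm; set z := zcode _ _ _.
have [h [hm hg gh]] := scale_ex g1 gm.
(* Two bits of the code per quadtree level. *)
set I := 2 * (m - h.-1).
set k := num_within P c g.
have hI : 2 * m - I = 2 * h.-1 by rewrite /I; lia.
have ct : count (fun y => y %/ 2 ^ (2 * m - I) == z %/ 2 ^ (2 * m - I)) l
    < 2 ^ (trunc_log 2 k).+1.
  apply: leq_ltn_trans (trunc_log_ltn k (isT : 1 < 2)).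
  apply: (@count_codes m P _ [pred p : cell m | (p \in P) && (dist R p c <= g)%R]).
  move=> y hy yP /eqP; rewrite /= hI expnM -/(4) yP => e.
  have hm' : h.-1 <= m by lia.
  apply: (dist_le (le_trans ler01 g1) hg) => /=.
    by rewrite xcoord_div // e -xcoord_div // xcoord_zcode.
  by rewrite ycoord_div // e -ycoord_div // ycoord_zcode.
have same : same_cell (2 * m - 0) l.
  move=> x y /codes_lt hx /codes_lt hy; rewrite subn0 expnM.
  by rewrite !divn_small.
have IM : I <= 2 * m by rewrite /I leq_mul2l leq_subr.
have := steps_level (size l) (leq0n I) IM (sorted_codes P) same ct.
rewrite muln0 subn0 => hs.
have gpos : (0 < g)%R := lt_le_trans ltr01 g1.
set X := lg ((2 ^ m)%:R / g)%R; set Y := lg (maxn 1 k)%:R%R.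
have X0 : (0 <= X)%R by rewrite lg_ge0 // ler_pdivlMr // mul1r.
have hX : ((m - h.-1)%:R <= X + 2)%R.
  have [le2|gt2] := leqP (m - h.-1) 2.
    by apply: le_trans (_ : 2%:R <= _)%R; [rewrite ler_nat | lra].
  have -> : m - h.-1 = (m - h.-1 - 2) + 2 by lia.
  rewrite natrD lerD2r -(lg_pow2 R); apply: le_lg; first by rewrite ltr0n expn_gt0.
  rewrite ler_pdivlMr //.
  apply: le_trans (_ : (2 ^ (m - h.-1 - 2))%:R * (2 ^ h.+1)%:R <= _)%R.
    by rewrite ler_wpM2l // ltW.
  by rewrite -natrM -expnD ler_nat leq_exp2l //; lia.
have hY : ((trunc_log 2 k)%:R <= Y)%R.
  rewrite -(lg_pow2 R); apply: le_lg; first by rewrite ltr0n expn_gt0.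
  rewrite ler_nat; case: (posnP k) => [->|k0]; first by rewrite trunc_log0.
  by rewrite (maxn_idPr k0) trunc_logP.
have : ((steps z (build (2 * m) (size l) 0 l))%:R
   <= 8 * (m - h.-1)%:R + 4 * (trunc_log 2 k)%:R + 8 :> R)%R.
  by rewrite -!natrM -!natrD ler_nat; apply: leq_trans hs _; rewrite /I; lia.
have Y0 : (0 <= Y)%R by apply: le_trans hY.
by move: X0 hX hY Y0; move: X Y => X Y; lra.
Qed.

Lemma query_bound_le (R : realType) m (P : {set cell m}) c (g : R) :
  (1 <= g)%R -> (g <= (2 ^ m)%:R)%R ->
  (query_bound R P c <= lg ((2 ^ m)%:R / g) + lg (maxn 1 (num_within P c g))%:R)%R.
Proof.
move=> g1 gm; apply: ge_inf; last by exists g.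
exists 0%R => v [g' [g1' gm' ->]]; have g0 := lt_le_trans ltr01 g1'.
by rewrite addr_ge0 // lg_ge0 // ?ler_pdivlMr ?mul1r // ler1n leq_maxl.
Qed.

(** A time bound shown for every [g] passes to the infimum, attained or not; [g = 1] shows that the
    set of values is nonempty. *)
Lemma le_query_bound (R : realType) m (P : {set cell m}) c (a : R) :
  (forall g : R, (1 <= g)%R -> (g <= (2 ^ m)%:R)%R ->
     (a <= lg ((2 ^ m)%:R / g) + lg (maxn 1 (num_within P c g))%:R)%R) ->
  (a <= query_bound R P c)%R.
Proof.
move=> H; apply: lb_le_inf.
  exists (lg ((2 ^ m)%:R / 1) + lg (maxn 1 (num_within P c (1 : R)))%:R)%R.
  by exists 1%R; split=> //; rewrite ler1n expn_gt0.
by move=> v [g [g1 gm ->]]; apply: H.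
Qed.

(** Take [g] to be the side of the grid: the first logarithm vanishes. *)
Lemma query_bound_card (R : realType) m (P : {set cell m}) c :
  (query_bound R P c <= lg (maxn 1 #|P|)%:R)%R.
Proof.
have u1 : (1 <= (2 ^ m)%:R :> R)%R by rewrite ler1n expn_gt0.
apply: le_trans (query_bound_le P c u1 (lexx _)) _.
rewrite divff ?gt_eqF ?(lt_le_trans ltr01) // /lg ln1 mul0r add0r.
apply: le_lg; first by rewrite ltr0n leq_max.
rewrite ler_nat geq_max leq_maxl /= leq_max; apply/orP; right.
by apply: subset_leq_card; apply/fintype.subsetP => p; rewrite inE => /andP [].
Qed.

Lemma query_bound_ge0 (R : realType) m (P : {set cell m}) c :
  (0 <= query_bound R P c)%R.
Proof.
apply: le_query_bound => g g1 gm; have g0 := lt_le_trans ltr01 g1.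
by rewrite addr_ge0 // lg_ge0 // ?ler_pdivlMr ?mul1r // ler1n leq_maxl.
Qed.

Theorem theorem2 (R : realType) :
  exists a : nat, forall b : nat,
  exists (p : prog) (C : nat),
  forall (m w : nat) (P : {set cell m}),
    (a * m.+1 <= w)%N -> (w <= b * m.+1)%N ->
    ones_at_bottom P ->
    exists B : seq bool,
      [/\ (size B <= C * num_nodes (quadtree P))%N,
          (size B <= w * 2 ^ w)%N
        & forall c : cell m,
            answers w p B P c (C%:R * (1 + query_bound R P c))%R /\
            (query_bound R P c <= C%:R * (1 + lg (maxn 1 #|P|)%:R))%R].
Proof.
(* 64 yields [7 * m + 45 <= w] and keeps all addresses below [2 ^ w]. In [C], [4 * b] covers header
   and padding, 61 the tree, and [81 * 25] the time [81 * (24 + 8 * v) + 15]. *)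
exists 64 => b; set C := 4 * b + 61 + 81 * 25; exists main_prog, C => m w P mw wb ob.
have C1 : (1 <= C%:R :> R)%R by rewrite ler1n /C; lia.
have card_bound c : (query_bound R P c <= C%:R * (1 + lg (maxn 1 #|P|)%:R))%R.
  apply: le_trans (query_bound_card R P c) _.
  have : (0 <= lg (maxn 1 #|P|)%:R :> R)%R by rewrite lg_ge0 // ler1n leq_maxl.
  by move: C1; move: (C%:R)%R (lg _) => x y; nra.
have w1 : 1 < w by lia.
have W0 : 0 < 2 ^ w by rewrite expn_gt0.
have N0 : 0 < num_nodes (quadtree P) by case: (quadtree P).
have [P0|Pn0] := eqVneq P finset.set0.
  (* For the empty set a single 0 bit makes the first word even, whatever the other bits are. *)
  exists [:: false]; split; rewrite ?muln_gt0 ?N0 ?W0 //=; try by rewrite /C; lia.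
  move=> c; split=> // M st.
  have M0 : M (to_word w 0) %% 2 = 0.
    have := st 0 isT; rewrite div0n mod0n testbitE expn0 divn1 /= modn2.
    by move=> ->.
  have [s [ex [hM hs]]] := @main_empty w M c.1 c.2 w1 M0 _ (query_state_env M c ltac:(lia)).
  exists 8, s; split=> //; first by rewrite (hs 0) // P0 inE.
    by rewrite hM.
  apply: le_trans (_ : C%:R * 1 <= _)%R; first by rewrite mulr1 ler_nat /C; lia.
  by rewrite ler_wpM2l // lerDl query_bound_ge0.
set l := codes P; set t := build (2 * m) (size l) 0 l.
set hi := (4 ^ m).-1.
have kt : keys t = l by rewrite keys_build.
have [tb mN] := tree_bits_codes ob kt Pn0.
have bt : between 0 hi (keys t) by rewrite kt between_codes.
(* The padding ensures that the second word of every window read is still part of the string. *)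
set L := 2 * w + tree_bits m 0 hi t; set n := L %/ w + 2.
set V := header w m (tree_code m 0 hi t).
have p4 : 0 < 4 ^ m by rewrite expn_gt0.
have tbQ : tree_bits m 0 hi t < 2 ^ (w - 2).
  apply: leq_trans (tree_bits_lt (leq0n _) _ bt (split_height_bound _ _ _)) _.
    by rewrite ltn_predL.
  by rewrite leq_exp2l //; lia.
have WQ : 2 ^ w = 4 * 2 ^ (w - 2) by rewrite -[4]/(2 ^ 2) -expnD; congr (_ ^ _); lia.
have w2Q : 2 * w + 2 < 2 * 2 ^ (w - 2).
  by have := @double_lt_exp (w - 2) ltac:(lia); lia.
have Lw : L + 2 < 2 ^ w by rewrite WQ /L; lia.
have Ln : L %/ w + 1 < n by rewrite /n ltn_add2l.
have mw7 : 7 * m + 45 <= w by lia.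
have Lw' : L < 2 ^ w by apply: leq_ltn_trans Lw; rewrite leq_addr.
have nw : n <= 2 ^ w.
  by apply: leq_trans (ltnW Lw); rewrite leq_add2r leq_div.
have nL : n * w <= L + 2 * w by rewrite mulnDl leq_add2r leq_divM.
exists (mkseq (Nat.testbit V) (n * w)); rewrite size_mkseq; split.
- apply: leq_trans nL _; rewrite /L.
  (* Constantly many words are linear in the number of nodes, because a nonempty quadtree here has
     more than [m] of them. *)
  have : w <= b * num_nodes (quadtree P) by apply: leq_trans wb _; rewrite leq_mul2l mN orbT.
  rewrite /C !mulnDl -mulnA; move: tb; rewrite -/hi.
  by move: (num_nodes _) (tree_bits _ _ _ _) => N tbits; move: (b * N) (61 * N); lia.
- by rewrite mulnC leq_mul2l nw orbT.
move=> c; split=> // M st.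
have hM := stores_holds (ltnW w1) st.
have zlt := zcode_lt m c.1 c.2.
have [T hT tr] := @main_nonempty m w M n (zcode m c.1 c.2) t mw7 nw Ln
  Lw' hM zlt bt.
have := tr; rewrite xcoord_zcode // ycoord_zcode // => {}tr.
have [s [ex [hMs hs]]] := tr _ (query_state_env M c ltac:(lia)).
exists T, s; split=> //.
- rewrite (hs 0) //= kt mem_codes //; congr (nat_of_bool (_ \in P)).
  case: (c) => x y; congr (_, _); apply: val_inj => /=.
    by rewrite xcoord_zcode.
  by rewrite ycoord_zcode.
- by rewrite hMs.
have C0 : (0 < C%:R :> R)%R by apply: lt_le_trans C1.
(* Isolating the infimum reduces the time bound to one inequality for each [g]. *)
rewrite mulrC -ler_pdivrMr // -lerBlDl.
apply: le_query_bound => g g1 gm; rewrite lerBlDl ler_pdivrMr //.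
have hs' := steps_le P c g1 gm.
set v := (lg (_ / g) + _)%R in hs' *.
have v0 : (0 <= v)%R.
  exact: (le_trans (query_bound_ge0 R P c) (query_bound_le P c g1 gm)).
have : (T%:R <= 81 * (steps (zcode m c.1 c.2) t)%:R + 15 :> R)%R.
  by rewrite -natrM -natrD ler_nat.
have : (81 * 25 <= C%:R :> R)%R by rewrite -natrM ler_nat leq_addl.
by move: hs' v0; rewrite -/l -/t; move: v (C%:R)%R (T%:R)%R (_%:R)%R => v x y u; nra.
Qed.
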